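(* In the setting below, let $b_1,\dots,b_n$ be prescribed positive numbers and let $w(0)\in W$. Consider the combinatorial Yamabe flow $\frac{dw_i(t)}{dt}=B_i(w(t))-b_i$, $i=1,\dots,n$, with initial value $w(0)$. Then the solution $w(t)$ exists and stays in $W$ for all $t\in[0,\infty)$, and converges exponentially fast as $t\to\infty$ to an admissible discrete conformal factor $w^*\in W$ for which the hyperbolic surface $\Sigma_{w^**l^0}$ has geodesic boundary components of lengths $b_1,\dots,b_n$, i.e. $B_i(w^* )=b_i$ for all $i$. That is, there are constants $C,\lambda_0>0$ with $|w_i(t)-w_i^*|\le Ce^{-\lambda_0 t}$ for all $i$ and $t\ge 0$.
   Context: Setting: $T^*$ is a triangulation of a closed surface $S$ with vertex set $T^0$; $\Sigma=S\setminus N(T^0)$ where $N(T^0)$ is a small open regular disjoint neighborhood of $T^0$; $\Sigma$ has boundary components labeled $1,\dots,n$. $T=T^*\cap\Sigma$ is the ideal triangulation with ideal edges $E$ and ideal faces $F$; $ij$ denotes the ideal edge between boundary components $i,j$ and $ijk$ the ideal face adjacent to boundary components $i,j,k$. A discrete hyperbolic metric is $l\in\mathbb{R}_+^{|E|}$. For each face $ijk$ there is a right-angled hyperbolic hexagon, unique up to isometry, with pairwise non-adjacent sides of lengths $l_{ij},l_{jk},l_{ki}$; gluing gives a hyperbolic surface $\Sigma_l$ with geodesic boundary. $\theta_i^f$ is the length of the hexagon side of face $f=ijk$ opposite to the side of length $l_{jk}$, given by $\cosh\theta_i^f=\frac{\cosh l_{jk}+\cosh l_{ki}\cosh l_{ij}}{\sinh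 l_{ki}\sinh l_{ij}}$. Fix $l^0\in\mathbb{R}_+^{|E|}$. $W=\{w\in\mathbb{R}^n: w_i+w_j>-\ln\cosh\frac{l^0_{ij}}{2}\ \forall ij\in E\}$ is the set of admissible discrete conformal factors; for $w\in W$, $l=w*l^0$ is given by $\cosh\frac{l_{ij}}{2}=e^{w_i+w_j}\cosh\frac{l^0_{ij}}{2}$, and $B_i(w)=\sum_{f\in F_i}\theta_i^f$ (with $F_i$ the set of faces adjacent to boundary component $i$) is the length of boundary component $i$ of $\Sigma_{w*l^0}$. *)

(* Defs.v *)
From Stdlib Require Import Reals Lra List Relations.
From Coquelicot Require Import Coquelicot.
Open Scope R_scope.

Definition acosh (x : R) : R := ln (x + sqrt (x ^ 2 - 1)).

Definition nxt (k : nat) : nat := S k mod 3.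

(* Combinatorial data of a triangulation T^* of a closed surface S.   *)
(* Vertices (= boundary components of Sigma) : 0 .. n-1.              *)
(* Edges : 0 .. m-1, edge e oriented from esrc e to etgt e.           *)
(* Faces : 0 .. F-1; face f has corners k = 0,1,2 at vertices fv f k;  *)
(* fe f k is the edge of f opposite to corner k (its endpoints are the *)
(* corners nxt k and nxt (nxt k)); fo f k = true iff the orientation   *)
(* of fe f k goes from corner nxt k to corner nxt (nxt k) of f.        *)
(* Multiple edges and loops are allowed.                               *)
Record tri_data := mkTri {
  nV : nat; nE : nat; nF : nat;
  esrc : nat -> nat; etgt : nat -> nat;
  fv : nat -> nat -> nat; fe : nat -> nat -> nat; fo : nat -> nat -> bool }.

(* corner (f, c) touches the source end of the edge in slot j of f *)
Definition touch_src (T : tri_data) (f j c : nat) : bool :=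
  Bool.eqb (fo T f j) (Nat.eqb c (nxt j)).

Definition is_corner (T : tri_data) (p : nat * nat) : Prop :=
  (fst p < nF T)%nat /\ (snd p < 3)%nat.

(* two corners are adjacent in the vertex link: they contain (in one of
   their two incident edge slots) the same edge, at the same end of it *)
Definition corner_adj (T : tri_data) (p q : nat * nat) : Prop :=
  is_corner T p /\ is_corner T q /\
  exists j j', j <> snd p /\ (j < 3)%nat /\ j' <> snd q /\ (j' < 3)%nat /\
    fe T (fst p) j = fe T (fst q) j' /\
    touch_src T (fst p) j (snd p) = touch_src T (fst q) j' (snd q).

Definition edge_multiplicity (T : tri_data) (e : nat) : nat :=
  length (filter (fun p : nat * nat => Nat.eqb (fe T (fst p) (snd p)) e)
    (list_prod (seq 0 (nF T)) (seq 0 3))).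

(* T is a triangulation of a closed surface with vertex set {0..n-1}:
   well-formed incidences, each edge glued to exactly two face sides,
   every vertex is a vertex of some face, and every vertex link is
   connected (so the gluing is a closed surface). *)
Definition closed_surface_triangulation (T : tri_data) : Prop :=
  (forall e, (e < nE T)%nat -> (esrc T e < nV T)%nat /\ (etgt T e < nV T)%nat) /\
  (forall f k, (f < nF T)%nat -> (k < 3)%nat ->
     (fv T f k < nV T)%nat /\ (fe T f k < nE T)%nat /\
     (if fo T f k
      then esrc T (fe T f k) = fv T f (nxt k) /\ etgt T (fe T f k) = fv T f (nxt (nxt k))
      else esrc T (fe T f k) = fv T f (nxt (nxt k)) /\ etgt T (fe T f k) = fv T f (nxt k))) /\
  (forall e, (e < nE T)%nat -> edge_multiplicity T e = 2%nat) /\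
  (forall v, (v < nV T)%nat -> exists f k, (f < nF T)%nat /\ (k < 3)%nat /\ fv T f k = v) /\
  (forall v p q, (v < nV T)%nat ->
     is_corner T p -> fv T (fst p) (snd p) = v ->
     is_corner T q -> fv T (fst q) (snd q) = v ->
     clos_refl_trans _ (corner_adj T) p q).

(* theta_i^f : length of the hexagon side of face f at corner k,
   opposite to the side of length l (fe f k):
   cosh theta = (cosh l_jk + cosh l_ki cosh l_ij)/(sinh l_ki sinh l_ij). *)
Definition theta (T : tri_data) (l : nat -> R) (f k : nat) : R :=
  let lo := l (fe T f k) in
  let la := l (fe T f (nxt k)) in
  let lb := l (fe T f (nxt (nxt k))) in
  acosh ((cosh lo + cosh la * cosh lb) / (sinh la * sinh lb)).

Definition admissible (T : tri_data) (l0 : nat -> R) (w : nat -> R) : Prop :=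
  forall e, (e < nE T)%nat ->
    w (esrc T e) + w (etgt T e) > - ln (cosh (l0 e / 2)).

(* l = w * l0 :  cosh (l_ij / 2) = e^{w_i + w_j} cosh (l0_ij / 2) *)
Definition conf_metric (T : tri_data) (l0 : nat -> R) (w : nat -> R) : nat -> R :=
  fun e => 2 * acosh (exp (w (esrc T e) + w (etgt T e)) * cosh (l0 e / 2)).

(* B_i(w) = sum over corners at vertex i of theta : the length of the
   i-th boundary component of Sigma_{w*l0}. *)
Definition Blen (T : tri_data) (l0 : nat -> R) (w : nat -> R) (i : nat) : R :=
  fold_right Rplus 0
    (map (fun p : nat * nat =>
            if Nat.eqb (fv T (fst p) (snd p)) i
            then theta T (conf_metric T l0 w) (fst p) (snd p) else 0)
         (list_prod (seq 0 (nF T)) (seq 0 3))).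

Definition yamabe_solution (T : tri_data) (l0 b w0 : nat -> R)
    (w : R -> nat -> R) : Prop :=
  (forall i, (i < nV T)%nat -> w 0 i = w0 i) /\
  (forall t, 0 <= t -> admissible T l0 (w t)) /\
  (forall i, (i < nV T)%nat ->
     filterlim (fun t => w t i) (at_right 0) (locally (w0 i))) /\
  (forall i t, (i < nV T)%nat -> 0 < t ->
     is_derive (fun s => w s i) t (Blen T l0 (w t) i - b i)).

(* Main.v *)
From Stdlib Require Import Reals Lra Lia List.
From Coquelicot Require Import Coquelicot.
Require Import Defs.
Open Scope R_scope.

(** Along the flow the energy [sum_i (B_i - b_i)^2] decreases, because on every face the
    Jacobian of the three hexagon sides with respect to the conformal factors is symmetric and
    strictly diagonally dominant with negative diagonal.  Bounded energy bounds all hexagon sides,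
    and a bounded hexagon side at a vertex keeps the adjacent edges from degenerating and bounds
    the factor of that vertex from below.  Conversely a very large factor makes the boundary
    component shorter than [b_i], so the flow pushes it back.  Hence the trajectory stays in a
    fixed compact part of [W], where the diagonal dominance is uniform: the energy, and with it
    the speed, decays exponentially and [w] converges to a zero of [B - b].  For existence, the
    field truncated slightly outside that compact part is globally Lipschitz, and its solution
    never reaches the place where the truncation matters. *)

(** * Finite sums *)

(** The logarithms [y = ln (cosh (l / 2))] of the edges are affine in [w], and [W] is the region
    where they are all positive. Up to controlled factors, a hexagon side is governed by the ratio
    [exp (2 (y1 - y2 - y3))], where [y1] belongs to the edge opposite to the corner. In this
    exponent the factors at the two other corners cancel and [-4 w_i] plus a constant remains. Hence
    a bound on one side controls one factor alone, and a large factor shortens the sides at its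
    vertex.

    It is not known in advance that the lengths [b] are attained, so neither the distance to [w*]
    nor the minimum of a potential is available as a Lyapunov function. The squared speed refers to
    no target, and [w*] is produced as the limit of the flow itself.

    The a priori bounds concern an arbitrary flow on an arbitrary interval and depend on the initial
    value only. They therefore serve twice: to keep the solution of the truncated field away from
    the truncation, and to prove convergence of every given solution. *)

Definition lsum {A : Type} (f : A -> R) (l : list A) : R :=
  fold_right Rplus 0 (map f l).

Lemma lsum_le {A : Type} (f g : A -> R) (l : list A) :
  (forall x, In x l -> f x <= g x) -> lsum f l <= lsum g l.
Proof.
  unfold lsum; induction l as [|a l IH]; simpl; intros H; [lra|].
  apply Rplus_le_compat; [apply H; now left|apply IH; intros; apply H; now right].
Qed.

Lemma lsum_ext {A : Type} (f g : A -> R) (l : list A) :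
  (forall x, In x l -> f x = g x) -> lsum f l = lsum g l.
Proof.
  intros H; apply Rle_antisym; apply lsum_le; intros x Hx; rewrite (H x Hx); lra.
Qed.

Lemma lsum_const {A : Type} (c : R) (l : list A) :
  lsum (fun _ => c) l = INR (length l) * c.
Proof.
  unfold lsum; induction l as [|a l IH]; cbn [map fold_right length]; [simpl; ring|].
  rewrite IH, S_INR; ring.
Qed.

Lemma lsum_ge0 {A : Type} (f : A -> R) (l : list A) :
  (forall x, In x l -> 0 <= f x) -> 0 <= lsum f l.
Proof.
  intros H; apply Rle_trans with (lsum (fun _ => 0) l).
  - rewrite lsum_const; lra.
  - now apply lsum_le.
Qed.

Lemma lsum_plus {A : Type} (f g : A -> R) (l : list A) :
  lsum (fun x => f x + g x) l = lsum f l + lsum g l.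
Proof. unfold lsum; induction l as [|a l IH]; simpl; [ring|rewrite IH; ring]. Qed.

Lemma lsum_scal {A : Type} (c : R) (f : A -> R) (l : list A) :
  lsum (fun x => c * f x) l = c * lsum f l.
Proof. unfold lsum; induction l as [|a l IH]; simpl; [ring|rewrite IH; ring]. Qed.

Lemma lsum_ge_term {A : Type} (f : A -> R) (l : list A) (a : A) :
  (forall x, In x l -> 0 <= f x) -> In a l -> f a <= lsum f l.
Proof.
  induction l as [|x l IH]; intros H Ha; [easy|].
  assert (H1 : 0 <= lsum f l) by (apply lsum_ge0; intros; apply H; now right).
  assert (H2 : 0 <= f x) by (apply H; now left).
  change (f a <= f x + lsum f l).
  destruct Ha as [->|Ha]; [lra|].
  assert (f a <= lsum f l) by (apply IH; [intros; apply H; now right|easy]). lra.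
Qed.

Lemma lsum_exchange {A B : Type} (f : A -> B -> R) (l : list A) (l' : list B) :
  lsum (fun x => lsum (fun y => f x y) l') l = lsum (fun y => lsum (fun x => f x y) l) l'.
Proof.
  induction l as [|a l IH].
  - change (0 = lsum (fun _ : B => 0) l'). rewrite lsum_const; ring.
  - change (lsum (fun y => f a y) l' + lsum (fun x => lsum (fun y => f x y) l') l =
            lsum (fun y => f a y + lsum (fun x => f x y) l) l').
    rewrite lsum_plus, IH; reflexivity.
Qed.

Lemma lsum_app {A : Type} (f : A -> R) (l l' : list A) :
  lsum f (l ++ l') = lsum f l + lsum f l'.
Proof.
  unfold lsum; induction l as [|a l IH]; simpl; [ring|rewrite IH; ring].
Qed.

Lemma lsum_list_prod {A B : Type} (f : A * B -> R) (l : list A) (l' : list B) :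
  lsum f (list_prod l l') = lsum (fun x => lsum (fun y => f (x, y)) l') l.
Proof.
  induction l as [|a l IH]; [easy|].
  simpl list_prod; rewrite lsum_app, IH.
  change (lsum f (map (fun y => (a, y)) l') + lsum (fun x => lsum (fun y => f (x, y)) l') l
          = lsum (fun y => f (a, y)) l' + lsum (fun x => lsum (fun y => f (x, y)) l') l).
  f_equal; unfold lsum; now rewrite map_map.
Qed.

Lemma lsum_delta (g : nat -> R) (v n : nat) :
  (v < n)%nat -> lsum (fun i => if Nat.eqb v i then g i else 0) (seq 0 n) = g v.
Proof.
  induction n as [|n IH]; intros Hv; [lia|].
  rewrite seq_S, lsum_app;
  change (lsum (fun i => if Nat.eqb v i then g i else 0) (0 + n :: nil)%nat)
    with ((if Nat.eqb v n then g n else 0) + 0).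
  destruct (Nat.eqb_spec v n) as [->|Hne].
  - rewrite (lsum_ext _ (fun _ => 0)).
    + rewrite lsum_const; ring.
    + intros i Hi; apply in_seq in Hi; destruct (Nat.eqb_spec n i); [lia|easy].
  - rewrite IH by lia; ring.
Qed.

Lemma is_derive_lsum {A : Type} (f : A -> R -> R) (df : A -> R) (l : list A) (t : R) :
  (forall x, In x l -> is_derive (f x) t (df x)) ->
  is_derive (fun s => lsum (fun x => f x s) l) t (lsum df l).
Proof.
  induction l as [|a l IH]; intros H.
  - apply (is_derive_const (V := R_NormedModule) 0 t).
  - apply (is_derive_plus (V := R_NormedModule) (f a) (fun s => lsum (fun x => f x s) l)).
    + apply H; now left.
    + apply IH; intros; apply H; now right.
Qed.

Lemma filterlim_lsum {A : Type} (F : (R -> Prop) -> Prop) {FF : Filter F}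
  (f : A -> R -> R) (y : A -> R) (l : list A) :
  (forall x, In x l -> filterlim (f x) F (locally (y x))) ->
  filterlim (fun s => lsum (fun x => f x s) l) F (locally (lsum y l)).
Proof.
  induction l as [|a l IH]; intros H.
  - apply filterlim_const.
  - apply (filterlim_comp_2 (f a) (fun s => lsum (fun x => f x s) l) Rplus
            (G := locally (y a)) (H := locally (lsum y l))).
    + apply H; now left.
    + apply IH; intros; apply H; now right.
    + apply (filterlim_plus (V := R_NormedModule)).
Qed.

Lemma finite_upper_bound (f : nat -> R) (n : nat) :
  exists M, 0 <= M /\ forall i, (i < n)%nat -> f i <= M.
Proof.
  induction n as [|n [M [HM IH]]]; [exists 0; split; [lra|lia]|].
  exists (Rmax M (f n)); split; [apply Rle_trans with M; [easy|apply Rmax_l]|].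
  intros i Hi; destruct (Nat.eq_dec i n) as [->|]; [apply Rmax_r|].
  apply Rle_trans with M; [apply IH; lia|apply Rmax_l].
Qed.

Lemma finite_pos_lower_bound (f : nat -> R) (n : nat) :
  (forall i, (i < n)%nat -> 0 < f i) ->
  exists m, 0 < m <= 1 /\ forall i, (i < n)%nat -> m <= f i.
Proof.
  induction n as [|n IH]; intros H; [exists 1; split; [lra|lia]|].
  destruct IH as [m [Hm IH]]; [intros; apply H; lia|].
  assert (Hn := H n (Nat.lt_succ_diag_r n)).
  exists (Rmin m (f n)); split.
  - split; [now apply Rmin_glb_lt|apply Rle_trans with m; [apply Rmin_l|easy]].
  - intros i Hi; destruct (Nat.eq_dec i n) as [->|]; [apply Rmin_r|].
    apply Rle_trans with m; [apply Rmin_l|apply IH; lia].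
Qed.

(** * Differential inequalities *)

Lemma derive_nonpos_decr (f df : R -> R) (a b : R) :
  (forall t, a < t < b -> is_derive f t (df t)) ->
  (forall t, a < t < b -> df t <= 0) ->
  forall s t, a < s -> s <= t -> t < b -> f t <= f s.
Proof.
  intros Hd Hn s t Hs Hst Ht.
  destruct (MVT_gen f s t df) as [c [Hc E]].
  - rewrite Rmin_left, Rmax_right by easy; intros x Hx; apply Hd; lra.
  - rewrite Rmin_left, Rmax_right by easy; intros x Hx.
    apply continuity_pt_filterlim, (ex_derive_continuous f); exists (df x); apply Hd; lra.
  - rewrite Rmin_left, Rmax_right in Hc by easy.
    assert (df c <= 0) by (apply Hn; lra). nra.
Qed.

Lemma at_right_le (f : R -> R) (a b l : R) :
  a < b -> filterlim f (at_right a) (locally l) ->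
  forall m, (forall s, a < s < b -> m <= f s) -> m <= l.
Proof.
  intros Hab Hl m Hm.
  apply (filterlim_le (F := at_right a) (fun _ => m) f m l); [|apply filterlim_const|exact Hl].
  assert (Hp : 0 < b - a) by lra.
  exists (mkposreal _ Hp); intros s Hs Has; apply Hm.
  change (Rabs (s - a) < b - a) in Hs; apply Rabs_def2 in Hs; lra.
Qed.

(** A solution of the flow is differentiable at positive times and takes its initial value as a
    right limit, so the comparison is with that limit instead of [f 0]. *)
Lemma derive_nonpos_decr0 (f df : R -> R) (b l : R) :
  filterlim f (at_right 0) (locally l) ->
  (forall t, 0 < t < b -> is_derive f t (df t)) ->
  (forall t, 0 < t < b -> df t <= 0) ->
  forall t, 0 < t < b -> f t <= l.
Proof.
  intros Hl Hd Hn t Ht.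
  apply (at_right_le f 0 t l); [lra|easy|].
  intros s Hs; apply (derive_nonpos_decr f df 0 b); easy || lra.
Qed.

(** Squaring the positive part removes its corner at 0, which makes it usable in the derivative
    tests above. *)
Lemma is_derive_sqr_pos_part (x : R) :
  is_derive (fun x => Rmax 0 x * Rmax 0 x) x (2 * Rmax 0 x).
Proof.
  destruct (Rtotal_order x 0) as [H|[->|H]].
  - apply (is_derive_ext_loc (fun _ => 0)).
    + assert (Hp : 0 < - x) by lra.
      exists (mkposreal _ Hp); intros s Hs; change (Rabs (s - x) < - x) in Hs.
      apply Rabs_def2 in Hs; rewrite Rmax_left by lra; exact (eq_sym (Rmult_0_r 0)).
    + rewrite Rmax_left by lra; rewrite Rmult_0_r.
      apply (is_derive_const (V := R_NormedModule) 0 x).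
  - rewrite Rmax_left by lra; rewrite Rmult_0_r.
    apply is_derive_Reals; intros eps Heps.
    exists (mkposreal _ Heps); intros h Hh Hhe; simpl in Hhe.
    rewrite Rplus_0_l, (Rmax_left 0 0) by lra.
    unfold Rmax; destruct (Rle_dec 0 h) as [Hp|Hp].
    + replace ((h * h - 0 * 0) / h - 0) with h by (field; easy); easy.
    + replace ((0 * 0 - 0 * 0) / h - 0) with 0 by (field; easy); rewrite Rabs_R0; lra.
  - apply (is_derive_ext_loc (fun x => x * x)).
    + exists (mkposreal _ H); intros s Hs; change (Rabs (s - x) < x) in Hs.
      apply Rabs_def2 in Hs; now rewrite Rmax_right by lra.
    + rewrite Rmax_right by lra; auto_derive; [easy|ring].
Qed.

(** The squared positive part of [f - M] has nonpositive derivative everywhere and starts at 0, so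
    it stays 0. This replaces an argument with a first crossing time. *)
Lemma barrier (f df : R -> R) (M l b : R) :
  l <= M ->
  filterlim f (at_right 0) (locally l) ->
  (forall t, 0 < t < b -> is_derive f t (df t)) ->
  (forall t, 0 < t < b -> M < f t -> df t <= 0) ->
  forall t, 0 < t < b -> f t <= M.
Proof.
  intros HlM Hl Hd Hn t Ht.
  set (p := fun x => Rmax 0 (x - M) * Rmax 0 (x - M)).
  assert (Hp : forall x, is_derive p x (2 * Rmax 0 (x - M))).
  { intros x. unfold p; rewrite <- (Rmult_1_l (2 * _)).
    apply (is_derive_comp (fun x => Rmax 0 x * Rmax 0 x) (fun x => x - M)).
    - apply is_derive_sqr_pos_part.
    - auto_derive; [easy|ring]. }
  assert (H : p (f t) <= p l).
  { apply (derive_nonpos_decr0 (fun s => p (f s)) (fun s => df s * (2 * Rmax 0 (f s - M))) b); try easy.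
    - eapply filterlim_comp; [exact Hl|].
      apply (ex_derive_continuous p l); eexists; apply Hp.
    - intros s Hs. apply (is_derive_comp p f); [apply Hp|now apply Hd].
    - intros s Hs; destruct (Rle_or_lt (f s) M) as [H|H].
      + rewrite Rmax_left by lra; lra.
      + rewrite Rmax_right by lra; assert (df s <= 0) by now apply Hn. nra. }
  unfold p in H; rewrite (Rmax_left 0 (l - M)) in H by lra.
  destruct (Rle_or_lt (f t) M) as [|C]; [easy|].
  rewrite Rmax_right in H by lra; nra.
Qed.

Lemma is_lim_scaled_exp_decay (c lam : R) :
  0 < lam -> is_lim (fun t => c * exp (- lam * t)) p_infty 0.
Proof.
  intros Hlam; evar_last.
  - apply is_lim_scal_l, is_lim_comp with m_infty.
    + apply is_lim_exp_m.
    + evar_last; [apply is_lim_scal_l, is_lim_id|].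
      simpl; destruct (Rle_dec 0 (- lam)); [exfalso; lra|easy].
    + exists 0; easy.
  - simpl; f_equal; ring.
Qed.

(** The function [E] is the integral of the speed bound from [t] to infinity. Both [f + E] and
    [- f + E] are nonincreasing, so [f] moves by at most [E s] after time [s]; this gives the Cauchy
    property and the rate at once. *)
Lemma exp_decay_limit (f df : R -> R) (S lam : R) :
  0 <= S -> 0 < lam ->
  (forall t, 0 < t -> is_derive f t (df t)) ->
  (forall t, 0 < t -> Rabs (df t) <= S * exp (- lam * t)) ->
  exists l : R, is_lim f p_infty l /\
    forall t, 0 < t -> Rabs (f t - l) <= S / lam * exp (- lam * t).
Proof.
  intros HS Hlam Hd Hb.
  set (E := fun t => S / lam * exp (- lam * t)).
  assert (HE : forall t, is_derive E t (- S * exp (- lam * t))).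
  { intros t; unfold E; auto_derive; [easy|field; lra]. }
  assert (HE0 : forall t, 0 <= E t).
  { intros t; unfold E; apply Rmult_le_pos; [apply Rdiv_le_0_compat; lra|apply Rlt_le, exp_pos]. }
  assert (Hst : forall s t, 0 < s -> s <= t -> Rabs (f t - f s) <= E s).
  { intros s t Hs Ht.
    assert (H1 : f t + E t <= f s + E s).
    { apply (derive_nonpos_decr (fun u => f u + E u) (fun u => df u + - S * exp (- lam * u)) 0 (t + 1)); try lra.
      - intros u Hu; apply (is_derive_plus (V := R_NormedModule) f E); [apply Hd; lra|apply HE].
      - intros u Hu; assert (H := Hb u (proj1 Hu)); assert (H' := Rle_abs (df u)); lra. }
    assert (H2 : - f t + E t <= - f s + E s).
    { apply (derive_nonpos_decr (fun u => - f u + E u) (fun u => - df u + - S * exp (- lam * u)) 0 (t + 1)); try lra.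
      - intros u Hu; apply (is_derive_plus (V := R_NormedModule) (fun u => - f u) E); [|apply HE].
        apply (is_derive_opp (V := R_NormedModule) f); apply Hd; lra.
      - intros u Hu; assert (H := Hb u (proj1 Hu)); assert (H' := Rabs_maj2 (df u)); lra. }
    assert (H3 := HE0 t). apply Rabs_le; lra. }
  assert (HElim : is_lim E p_infty 0) by now apply is_lim_scaled_exp_decay.
  assert (Hex : ex_finite_lim f p_infty).
  { apply (filterlim_locally_cauchy (F := Rbar_locally p_infty) f).
    intros eps.
    assert (He2 : 0 < eps / 2) by (destruct eps; simpl; lra).
    assert (HE' := HElim (fun y => Rabs (y - 0) < eps / 2)).
    destruct HE' as [M HM].
    { exists (mkposreal _ He2); intros y Hy; exact Hy. }
    set (M0 := Rmax M 0 + 1).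
    assert (HM0 : M < M0 /\ 0 < M0) by (unfold M0; split; assert (H := Rmax_l M 0); assert (H' := Rmax_r M 0); lra).
    exists (fun t => M0 < t); split; [exists M0; easy|].
    intros u v Hu Hv. change (Rabs (f v - f u) < eps).
    assert (H1 := Hst M0 u (proj2 HM0) (Rlt_le _ _ Hu)).
    assert (H2 := Hst M0 v (proj2 HM0) (Rlt_le _ _ Hv)).
    assert (H3 := HM M0 (proj1 HM0)). rewrite Rminus_0_r, (Rabs_pos_eq _ (HE0 M0)) in H3.
    replace (f v - f u) with ((f v - f M0) - (f u - f M0)) by ring.
    apply Rle_lt_trans with (1 := Rabs_triang _ _); rewrite Rabs_Ropp; lra. }
  destruct Hex as [l Hl]; exists l; split; [exact Hl|].
  intros t Ht.
  apply (filterlim_le (F := Rbar_locally p_infty) (fun u => Rabs (f t - f u)) (fun _ => E t)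
          (Rabs (f t - l)) (E t)).
  - exists t; intros u Hu; rewrite Rabs_minus_sym; apply Hst; lra.
  - apply (filterlim_comp _ _ _ (fun u => f t - f u) Rabs _ (locally (f t - l))).
    + apply (filterlim_comp _ _ _ f (fun x => f t - x) _ (locally l)); [exact Hl|].
      apply (continuous_minus (V := R_NormedModule) (fun _ => f t) (fun x => x));
        [apply continuous_const|apply continuous_id].
    + apply (continuous_Rabs (f t - l)).
  - apply filterlim_const.
Qed.

(** * Global solutions of Lipschitz differential equations *)

(** The remaining steps after index [k] add up to at most [2 c / 2^k]. Subtracting and adding this
    tail turns [x] into an increasing and a decreasing sequence, which are adjacent. *)
Lemma geometric_cauchy_limit (x : nat -> R) (c : R) :
  (forall k, Rabs (x (S k) - x k) <= c * (1 / 2) ^ k) ->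
  forall k, Rabs (real (Lim_seq x) - x k) <= 2 * c * (1 / 2) ^ k.
Proof.
  intros H.
  set (u := fun k => x k - 2 * c * (1 / 2) ^ k).
  set (v := fun k => x k + 2 * c * (1 / 2) ^ k).
  assert (Hg : is_lim_seq (fun k => 2 * c * (1 / 2) ^ k) 0).
  { evar_last.
    - apply is_lim_seq_scal_l, is_lim_seq_geom; rewrite Rabs_pos_eq; lra.
    - simpl; f_equal; ring. }
  assert (Hu : forall k, u k <= u (S k)).
  { intros k; unfold u; simpl; assert (H1 := Rabs_le_between (x (S k) - x k) (c * (1 / 2) ^ k)).
    destruct (proj1 H1 (H k)); lra. }
  assert (Hv : forall k, v (S k) <= v k).
  { intros k; unfold v; simpl; assert (H1 := Rabs_le_between (x (S k) - x k) (c * (1 / 2) ^ k)).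
    destruct (proj1 H1 (H k)); lra. }
  destruct (ex_lim_seq_adj u v Hu Hv) as [[lu Hlu] _].
  { apply (is_lim_seq_ext (fun k => 2 * (2 * c * (1 / 2) ^ k))).
    - intros k; unfold u, v; ring.
    - evar_last; [apply is_lim_seq_scal_l, Hg|simpl; f_equal; ring]. }
  assert (Hx : is_lim_seq x lu).
  { apply (is_lim_seq_ext (fun k => u k + 2 * c * (1 / 2) ^ k)).
    - intros k; unfold u; ring.
    - evar_last; [apply is_lim_seq_plus'; [exact Hlu|exact Hg]|simpl; f_equal; ring]. }
  assert (Hlv : is_lim_seq v lu).
  { evar_last; [apply is_lim_seq_plus'; [exact Hx|exact Hg]|simpl; f_equal; ring]. }
  rewrite (is_lim_seq_unique _ _ Hx); simpl; intros k.
  assert (H1 := is_lim_seq_incr_compare u lu Hlu Hu k).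
  assert (H2 := is_lim_seq_decr_compare v lu Hlv Hv k).
  unfold u in H1; unfold v in H2; apply Rabs_le; lra.
Qed.

Section PicardIteration.

Variables (n : nat) (G : (nat -> R) -> nat -> R) (M L : R) (x0 : nat -> R).
Hypothesis HM : 0 <= M.
Hypothesis HL : 0 < L.
Hypothesis Gbound : forall x i, (i < n)%nat -> Rabs (G x i) <= M.
Hypothesis Glip : forall x y d,
  (forall i, (i < n)%nat -> Rabs (x i - y i) <= d) ->
  forall i, (i < n)%nat -> Rabs (G x i - G y i) <= L * d.

(** The speed bound shared by all integral curves of a field bounded by [M]. It makes the integrands
    below continuous, and it is required for all real times so that integrability needs no side
    condition. *)
Definition path_lipschitz (x : R -> nat -> R) : Prop :=
  forall s t i, (i < n)%nat -> Rabs (x t i - x s i) <= M * Rabs (t - s).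

Lemma field_along_lipschitz_continuous (x : R -> nat -> R) (i : nat) :
  path_lipschitz x -> (i < n)%nat -> forall t, continuous (fun s => G (x s) i) t.
Proof.
  intros Hx Hi t; apply filterlim_locally; intros eps.
  assert (He := cond_pos eps).
  (* The summand 1 covers the case [M = 0]. *)
  assert (Hd : 0 < eps / (L * M + 1)) by (apply Rdiv_lt_0_compat; nra).
  exists (mkposreal _ Hd); intros s Hs; simpl in Hs.
  change (Rabs (s - t) < eps / (L * M + 1)) in Hs.
  change (Rabs (G (x s) i - G (x t) i) < eps).
  apply Rle_lt_trans with (L * (M * Rabs (s - t))).
  - apply Glip; [intros j Hj; now apply Hx|easy].
  - apply Rmult_lt_compat_r with (r := L * M + 1) in Hs; [|nra].
    replace (eps / (L * M + 1) * (L * M + 1)) with (pos eps) in Hs by (field; nra).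
    assert (H := Rabs_pos (s - t)); nra.
Qed.

Lemma field_along_lipschitz_ex_RInt (x : R -> nat -> R) (i : nat) :
  path_lipschitz x -> (i < n)%nat -> forall a b, ex_RInt (fun s => G (x s) i) a b.
Proof.
  intros Hx Hi a b; apply (ex_RInt_continuous (V := R_CompleteNormedModule)).
  intros t _; now apply field_along_lipschitz_continuous.
Qed.

Definition picard_step (x : R -> nat -> R) (t : R) (i : nat) : R :=
  x0 i + RInt (fun s => G (x s) i) 0 t.

Lemma picard_step_lipschitz (x : R -> nat -> R) :
  path_lipschitz x -> path_lipschitz (picard_step x).
Proof.
  intros Hx.
  assert (H : forall s t i, (i < n)%nat -> s <= t ->
    Rabs (picard_step x t i - picard_step x s i) <= M * (t - s)).
  { intros s t i Hi Hst; unfold picard_step.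
    assert (Hc := RInt_Chasles (fun s => G (x s) i) 0 s t
      (field_along_lipschitz_ex_RInt x i Hx Hi _ _) (field_along_lipschitz_ex_RInt x i Hx Hi _ _)).
    change (RInt (fun s => G (x s) i) 0 s + RInt (fun s => G (x s) i) s t
            = RInt (fun s => G (x s) i) 0 t) in Hc.
    assert (Hal : forall a b c d : R, b + c = d -> (a + d) - (a + b) = c) by (intros; lra).
    rewrite (Hal _ _ _ _ Hc).
    rewrite Rmult_comm; apply abs_RInt_le_const; [easy|now apply field_along_lipschitz_ex_RInt|].
    intros u _; now apply Gbound. }
  intros s t i Hi; destruct (Rle_or_lt s t) as [Hst|Hst].
  - rewrite (Rabs_pos_eq (t - s)) by lra; now apply H.
  - rewrite Rabs_minus_sym, (Rabs_minus_sym t s), (Rabs_pos_eq (s - t)) by lra.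
    apply H; [easy|lra].
Qed.

(* Iterating against the weight [exp (2 L t)] halves the error at each step, which
   gives a global solution at once. *)
Lemma picard_step_contraction (x y : R -> nat -> R) (c : R) :
  0 <= c -> path_lipschitz x -> path_lipschitz y ->
  (forall t i, 0 <= t -> (i < n)%nat -> Rabs (x t i - y t i) <= c * exp (2 * L * t)) ->
  forall t i, 0 <= t -> (i < n)%nat ->
    Rabs (picard_step x t i - picard_step y t i) <= c / 2 * exp (2 * L * t).
Proof.
  intros Hc Hx Hy H t i Ht Hi.
  assert (Ix := field_along_lipschitz_ex_RInt x i Hx Hi 0 t).
  assert (Iy := field_along_lipschitz_ex_RInt y i Hy Hi 0 t).
  unfold picard_step.
  assert (E := RInt_minus _ _ 0 t Ix Iy).
  change (RInt (fun s => G (x s) i - G (y s) i) 0 t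
          = RInt (fun s => G (x s) i) 0 t - RInt (fun s => G (y s) i) 0 t) in E.
  assert (Hal : forall a b c d : R, d = b - c -> (a + b) - (a + c) = d) by (intros; lra).
  rewrite (Hal _ _ _ _ E).
  assert (Im : ex_RInt (fun s => G (x s) i - G (y s) i) 0 t) by exact (ex_RInt_minus _ _ _ _ Ix Iy).
  assert (HE : is_RInt (fun s => L * (c * exp (2 * L * s))) 0 t
                 (c / 2 * exp (2 * L * t) - c / 2 * exp (2 * L * 0))).
  { apply (is_RInt_derive (V := R_CompleteNormedModule) (fun s => c / 2 * exp (2 * L * s))).
    - intros s _; auto_derive; [easy|field].
    - intros s _; apply (ex_derive_continuous (fun s => L * (c * exp (2 * L * s)))).
      auto_derive; easy. }
  apply Rle_trans with (RInt (fun s => Rabs (G (x s) i - G (y s) i)) 0 t);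
    [now apply abs_RInt_le|].
  apply Rle_trans with (RInt (fun s => L * (c * exp (2 * L * s))) 0 t).
  - apply RInt_le; [easy| |now eexists; apply HE|].
    + exact (ex_RInt_norm _ 0 t Im).
    + intros s Hs; apply Glip; [|easy]; intros j Hj; apply H; [lra|easy].
  - rewrite (is_RInt_unique _ _ _ _ HE), Rmult_0_r, exp_0; lra.
Qed.

Fixpoint picard_iter (k : nat) : R -> nat -> R :=
  match k with
  | O => fun _ => x0
  | S k => picard_step (picard_iter k)
  end.

Lemma picard_iter_lipschitz (k : nat) : path_lipschitz (picard_iter k).
Proof.
  induction k as [|k IH]; [|now apply picard_step_lipschitz].
  intros s t i _; simpl; rewrite Rminus_diag, Rabs_R0.
  apply Rmult_le_pos; [easy|apply Rabs_pos].
Qed.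

Lemma picard_iter_0 (k i : nat) : picard_iter k 0 i = x0 i.
Proof.
  destruct k; [easy|]; simpl; unfold picard_step; rewrite RInt_point.
  apply (Rplus_0_r (x0 i)).
Qed.

Lemma picard_iter_dist (k : nat) : forall t i, 0 <= t -> (i < n)%nat ->
  Rabs (picard_iter (S k) t i - picard_iter k t i) <= M / (2 * L) * (1 / 2) ^ k * exp (2 * L * t).
Proof.
  induction k as [|k IH]; intros t i Ht Hi.
  - rewrite pow_O, Rmult_1_r.
    assert (H := picard_iter_lipschitz 1 0 t i Hi); rewrite picard_iter_0 in H.
    change (picard_iter 0 t i) with (x0 i).
    rewrite Rminus_0_r, (Rabs_pos_eq t Ht) in H.
    apply Rle_trans with (1 := H).
    (* The linear growth of the first step is absorbed into the weight by [x <= exp x]; this is the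
       origin of the constant [M / (2 L)]. *)
    replace (M * t) with (M / (2 * L) * (2 * L * t)) by (field; lra).
    apply Rmult_le_compat_l; [apply Rdiv_le_0_compat; lra|].
    assert (H' := exp_ineq1_le (2 * L * t)); lra.
  - replace (M / (2 * L) * (1 / 2) ^ S k) with (M / (2 * L) * (1 / 2) ^ k / 2) by (simpl; field; lra).
    apply picard_step_contraction; try apply picard_iter_lipschitz; try easy.
    + apply Rmult_le_pos; [apply Rdiv_le_0_compat; lra|apply pow_le; lra].
    + exact (picard_iter_lipschitz (S k)).
Qed.

(** The iterates are controlled for nonnegative times only. Freezing the path at time 0 for negative
    [t] keeps it Lipschitz on the whole line, as [path_lipschitz] demands. *)
Definition picard_limit (t : R) (i : nat) : R :=
  real (Lim_seq (fun k => picard_iter k (Rmax 0 t) i)).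

Lemma picard_limit_dist (k : nat) (t : R) (i : nat) : 0 <= t -> (i < n)%nat ->
  Rabs (picard_limit t i - picard_iter k t i) <= M / L * (1 / 2) ^ k * exp (2 * L * t).
Proof.
  intros Ht Hi; unfold picard_limit; rewrite Rmax_right by easy.
  replace (M / L * (1 / 2) ^ k * exp (2 * L * t))
    with (2 * (M / (2 * L) * exp (2 * L * t)) * (1 / 2) ^ k) by (field; lra).
  apply (geometric_cauchy_limit (fun k => picard_iter k t i)); intros j.
  replace (M / (2 * L) * exp (2 * L * t) * (1 / 2) ^ j)
    with (M / (2 * L) * (1 / 2) ^ j * exp (2 * L * t)) by ring.
  now apply picard_iter_dist.
Qed.

Lemma le_of_geometric_error (a b c : R) :
  (forall k : nat, a <= b + c * (1 / 2) ^ k) -> a <= b.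
Proof.
  intros H.
  apply (is_lim_seq_le (fun _ => a) (fun k => b + c * (1 / 2) ^ k) a b H); [apply is_lim_seq_const|].
  evar_last.
  - apply is_lim_seq_plus'; [apply is_lim_seq_const|].
    apply (is_lim_seq_scal_l _ c (Finite 0)), is_lim_seq_geom; rewrite Rabs_pos_eq; lra.
  - simpl; f_equal; ring.
Qed.

Lemma picard_limit_lipschitz : path_lipschitz picard_limit.
Proof.
  assert (H : forall s t i, 0 <= s -> 0 <= t -> (i < n)%nat ->
    Rabs (picard_limit t i - picard_limit s i) <= M * Rabs (t - s)).
  { intros s t i Hs Ht Hi.
    apply le_of_geometric_error with (M / L * exp (2 * L * t) + M / L * exp (2 * L * s)); intros k.
    assert (H1 := picard_limit_dist k t i Ht Hi).
    assert (H2 := picard_limit_dist k s i Hs Hi).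
    assert (H3 := picard_iter_lipschitz k s t i Hi).
    replace (picard_limit t i - picard_limit s i)
      with ((picard_limit t i - picard_iter k t i) + (- (picard_limit s i - picard_iter k s i)
            + (picard_iter k t i - picard_iter k s i))) by ring.
    apply Rle_trans with (1 := Rabs_triang _ _).
    assert (H4 := Rabs_triang (- (picard_limit s i - picard_iter k s i)) (picard_iter k t i - picard_iter k s i)).
    rewrite Rabs_Ropp in H4; lra. }
  assert (E : forall t i, picard_limit t i = picard_limit (Rmax 0 t) i).
  { intros t i; unfold picard_limit; now rewrite (Rmax_right 0 (Rmax 0 t)) by apply Rmax_l. }
  intros s t i Hi; rewrite (E s), (E t).
  apply Rle_trans with (1 := H _ _ i (Rmax_l 0 s) (Rmax_l 0 t) Hi).
  apply Rmult_le_compat_l; [easy|].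
  unfold Rmax; destruct (Rle_dec 0 s), (Rle_dec 0 t); unfold Rabs; repeat destruct Rcase_abs; lra.
Qed.

Lemma picard_limit_fixed (t : R) (i : nat) :
  0 <= t -> (i < n)%nat -> picard_limit t i = picard_step picard_limit t i.
Proof.
  intros Ht Hi; apply Rminus_diag_uniq.
  assert (Rabs (picard_limit t i - picard_step picard_limit t i) <= 0).
  { apply le_of_geometric_error with (M / L * exp (2 * L * t)); intros k.
    assert (H1 := picard_limit_dist (S k) t i Ht Hi).
    assert (H2 : Rabs (picard_step picard_limit t i - picard_iter (S k) t i)
                 <= M / L * (1 / 2) ^ k / 2 * exp (2 * L * t)).
    { apply picard_step_contraction; try easy.
      - apply Rmult_le_pos; [apply Rdiv_le_0_compat; lra|apply pow_le; lra].
      - apply picard_limit_lipschitz.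
      - apply picard_iter_lipschitz.
      - intros; now apply picard_limit_dist. }
    replace (picard_limit t i - picard_step picard_limit t i)
      with ((picard_limit t i - picard_iter (S k) t i)
            + - (picard_step picard_limit t i - picard_iter (S k) t i)) by ring.
    apply Rle_trans with (1 := Rabs_triang _ _); rewrite Rabs_Ropp.
    simpl pow in H1; lra. }
  assert (H' := Rabs_pos (picard_limit t i - picard_step picard_limit t i)).
  apply Rabs_eq_0; lra.
Qed.

(** The Lipschitz bound belongs to the conclusion because it provides the right limit at time 0 and
    the bounded speed on which the continuation argument for the flow rests. *)
Theorem picard_lindelof_global :
  exists x : R -> nat -> R,
    (forall i, (i < n)%nat -> x 0 i = x0 i) /\
    path_lipschitz x /\
    (forall i t, (i < n)%nat -> 0 < t -> is_derive (fun s => x s i) t (G (x t) i)).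
Proof.
  exists picard_limit; split; [|split; [apply picard_limit_lipschitz|]].
  - intros i Hi; rewrite picard_limit_fixed by (lra || easy).
    unfold picard_step; rewrite RInt_point; apply (Rplus_0_r (x0 i)).
  - intros i t Hi Ht.
    apply (is_derive_ext_loc (fun s => picard_step picard_limit s i)).
    + exists (mkposreal _ Ht); intros s Hs; change (Rabs (s - t) < t) in Hs.
      apply Rabs_def2 in Hs; symmetry; apply picard_limit_fixed; [lra|easy].
    + unfold picard_step; evar_last.
      * apply (is_derive_plus (V := R_NormedModule) (fun _ => x0 i)); [apply is_derive_const|].
        apply (is_derive_RInt (fun s => G (picard_limit s) i) _ 0 t).
        -- apply filter_forall; intros u; apply (RInt_correct (V := R_CompleteNormedModule)).
           apply field_along_lipschitz_ex_RInt; [apply picard_limit_lipschitz|easy].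
        -- apply field_along_lipschitz_continuous; [apply picard_limit_lipschitz|easy].
      * apply plus_zero_l.
Qed.

End PicardIteration.

(** * Right-angled hexagons *)

Lemma acosh_arg_pos (x : R) : 1 <= x -> 1 <= x + sqrt (x ^ 2 - 1).
Proof. intros H; assert (H' := sqrt_pos (x ^ 2 - 1)); lra. Qed.

Lemma acosh_pos (x : R) : 1 <= x -> 0 <= acosh x.
Proof.
  intros H; unfold acosh; rewrite <- ln_1.
  apply Rcomplements.ln_le; [lra|now apply acosh_arg_pos].
Qed.

Lemma exp_acosh_ge (x : R) : 1 <= x -> x <= exp (acosh x).
Proof.
  intros H; unfold acosh; rewrite exp_ln by (assert (H' := acosh_arg_pos x H); lra).
  assert (H' := sqrt_pos (x ^ 2 - 1)); lra.
Qed.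

Lemma exp_opp_acosh (x : R) : 1 <= x -> exp (- acosh x) = x - sqrt (x ^ 2 - 1).
Proof.
  intros H; assert (H' := acosh_arg_pos x H); unfold acosh.
  rewrite exp_Ropp, exp_ln by lra.
  assert (E := sqrt_sqrt (x ^ 2 - 1)).
  apply Rmult_eq_reg_l with (x + sqrt (x ^ 2 - 1)); [|lra].
  rewrite Rinv_r by lra.
  replace ((x + sqrt (x ^ 2 - 1)) * (x - sqrt (x ^ 2 - 1)))
    with (x ^ 2 - sqrt (x ^ 2 - 1) * sqrt (x ^ 2 - 1)) by ring.
  rewrite E by nra; ring.
Qed.

Lemma cosh_acosh (x : R) : 1 <= x -> cosh (acosh x) = x.
Proof.
  intros H; unfold cosh; rewrite exp_opp_acosh by easy.
  unfold acosh; rewrite exp_ln by (assert (H' := acosh_arg_pos x H); lra). field.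
Qed.

Lemma cosh_double_acosh (x : R) : 1 <= x -> cosh (2 * acosh x) = 2 * x ^ 2 - 1.
Proof.
  intros H; rewrite <- (cosh_acosh x H) at 2.
  unfold cosh; replace (2 * acosh x) with (acosh x + acosh x) by ring.
  rewrite Ropp_plus_distr, !exp_plus.
  assert (E : exp (acosh x) * exp (- acosh x) = 1) by (rewrite <- exp_plus, Rplus_opp_r; apply exp_0).
  replace 1 with (exp (acosh x) * exp (- acosh x)); field.
Qed.

Lemma sinh_double_acosh (x : R) :
  1 <= x -> sinh (2 * acosh x) = sqrt ((2 * x ^ 2 - 1) ^ 2 - 1).
Proof.
  intros H; symmetry; apply sqrt_lem_1.
  - assert (1 <= x ^ 2) by nra; nra.
  - unfold sinh; assert (P := acosh_pos x H).
    assert (exp (- (2 * acosh x)) <= exp (2 * acosh x)); [|lra].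
    destruct (Req_dec (acosh x) 0) as [->|Hne]; [right; f_equal; ring|].
    left; apply exp_increasing; lra.
  - rewrite <- (cosh_double_acosh x H); unfold cosh, sinh.
    assert (E : exp (2 * acosh x) * exp (- (2 * acosh x)) = 1)
      by (rewrite <- exp_plus, Rplus_opp_r; apply exp_0).
    replace (((exp (2 * acosh x) + exp (- (2 * acosh x))) / 2) ^ 2 - 1)
      with (((exp (2 * acosh x) + exp (- (2 * acosh x))) / 2) ^ 2
            - exp (2 * acosh x) * exp (- (2 * acosh x))) by (rewrite E; ring).
    field.
Qed.

(* [a1], [a2], [a3] are the hyperbolic cosines of the three given sides. *)
Definition hex_cosh (a1 a2 a3 : R) : R :=
  (a1 + a2 * a3) / (sqrt (a2 ^ 2 - 1) * sqrt (a3 ^ 2 - 1)).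
Definition hex_side (a1 a2 a3 : R) : R := acosh (hex_cosh a1 a2 a3).

(** Minus the determinant of the Gram matrix with diagonal 1 and off-diagonal entries [-a1], [-a2],
    [-a3]. It is symmetric in its arguments, so the derivatives of the three sides share one
    denominator. *)
Definition hex_disc (a1 a2 a3 : R) : R :=
  a1 ^ 2 + a2 ^ 2 + a3 ^ 2 + 2 * a1 * a2 * a3 - 1.

Lemma sqrt_sqr_minus1 (a : R) : 1 < a ->
  0 < sqrt (a ^ 2 - 1) /\ sqrt (a ^ 2 - 1) * sqrt (a ^ 2 - 1) = a ^ 2 - 1 /\ sqrt (a ^ 2 - 1) <= a.
Proof.
  intros H; split; [apply sqrt_lt_R0; nra|]; split; [apply sqrt_sqrt; nra|].
  rewrite <- (sqrt_pow2 a) at 2 by lra. apply sqrt_le_1; nra.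
Qed.

Lemma hex_disc_pos (a1 a2 a3 : R) : 1 < a1 -> 1 < a2 -> 1 < a3 -> 0 < hex_disc a1 a2 a3.
Proof.
  intros H1 H2 H3; unfold hex_disc.
  assert (0 < a1 * a2 * a3) by (apply Rmult_lt_0_compat; [apply Rmult_lt_0_compat|]; lra). nra.
Qed.

Lemma hex_cosh_sqr_minus1 (a1 a2 a3 : R) : 1 < a1 -> 1 < a2 -> 1 < a3 ->
  hex_cosh a1 a2 a3 ^ 2 - 1
  = hex_disc a1 a2 a3 / (sqrt (a2 ^ 2 - 1) * sqrt (a3 ^ 2 - 1)) ^ 2.
Proof.
  intros H1 H2 H3; unfold hex_cosh, hex_disc.
  destruct (sqrt_sqr_minus1 a2 H2) as [P2 [E2 _]], (sqrt_sqr_minus1 a3 H3) as [P3 [E3 _]].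
  set (b2 := sqrt (a2 ^ 2 - 1)) in *; set (b3 := sqrt (a3 ^ 2 - 1)) in *.
  replace ((a1 + a2 * a3) / (b2 * b3)) with ((a1 + a2 * a3) * / (b2 * b3)) by easy.
  apply Rmult_eq_reg_r with ((b2 * b3) ^ 2); [|apply pow_nonzero; nra].
  transitivity ((a1 + a2 * a3) ^ 2 - (b2 * b2) * (b3 * b3)); [field; lra|].
  rewrite E2, E3; field; lra.
Qed.

Lemma hex_cosh_gt1 (a1 a2 a3 : R) : 1 < a1 -> 1 < a2 -> 1 < a3 -> 1 < hex_cosh a1 a2 a3.
Proof.
  intros H1 H2 H3; unfold hex_cosh.
  destruct (sqrt_sqr_minus1 a2 H2) as [P2 [_ L2]], (sqrt_sqr_minus1 a3 H3) as [P3 [_ L3]].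
  apply Rmult_lt_reg_r with (sqrt (a2 ^ 2 - 1) * sqrt (a3 ^ 2 - 1)); [nra|].
  unfold Rdiv; rewrite Rmult_assoc, Rinv_l by nra.
  assert (sqrt (a2 ^ 2 - 1) * sqrt (a3 ^ 2 - 1) <= a2 * a3) by (apply Rmult_le_compat; lra). lra.
Qed.

Lemma hex_cosh_ge_ratio (a1 a2 a3 : R) : 1 < a1 -> 1 < a2 -> 1 < a3 ->
  a1 / (a2 * a3) <= hex_cosh a1 a2 a3.
Proof.
  intros H1 H2 H3; unfold hex_cosh.
  destruct (sqrt_sqr_minus1 a2 H2) as [P2 [_ L2]], (sqrt_sqr_minus1 a3 H3) as [P3 [_ L3]].
  apply Rmult_le_compat; [lra|apply Rlt_le, Rinv_0_lt_compat; nra|nra|].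
  apply Rinv_le_contravar; [nra|]. apply Rmult_le_compat; lra.
Qed.

(** The numerator exceeds [a2 a3], hence the first root. So the side blows up when the adjacent edge
    with hyperbolic cosine [a3] shrinks to length 0. *)
Lemma hex_cosh_ge_inv (a1 a2 a3 : R) : 1 < a1 -> 1 < a2 -> 1 < a3 ->
  / sqrt (a3 ^ 2 - 1) <= hex_cosh a1 a2 a3.
Proof.
  intros H1 H2 H3; unfold hex_cosh.
  destruct (sqrt_sqr_minus1 a2 H2) as [P2 [_ L2]], (sqrt_sqr_minus1 a3 H3) as [P3 [_ L3]].
  apply Rmult_le_reg_r with (sqrt (a2 ^ 2 - 1) * sqrt (a3 ^ 2 - 1)); [nra|].
  unfold Rdiv; rewrite (Rmult_assoc _ (/ _)), Rinv_l by nra.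
  replace (/ sqrt (a3 ^ 2 - 1) * (sqrt (a2 ^ 2 - 1) * sqrt (a3 ^ 2 - 1)))
    with (sqrt (a2 ^ 2 - 1)) by (field; lra). nra.
Qed.

(** From [a - 1 <= sqrt (a^2 - 1)] one gets [a / sqrt (a^2 - 1)] below both [1 + 2 / a] and 2 for
    [a >= 2]. The sharp bound is used on the term tending to 1, the crude one on the ratio, whence
    the factor 4. *)
Lemma hex_cosh_le (a1 a2 a3 : R) : 1 < a1 -> 2 <= a2 -> 2 <= a3 ->
  hex_cosh a1 a2 a3 <= (1 + 2 / a2) * (1 + 2 / a3) + 4 * (a1 / (a2 * a3)).
Proof.
  intros H1 H2 H3; unfold hex_cosh.
  assert (Hb : forall a, 2 <= a -> a / (1 + 2 / a) <= sqrt (a ^ 2 - 1) /\ a / 2 <= sqrt (a ^ 2 - 1)).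
  { intros a Ha.
    assert (Hs : a - 1 <= sqrt (a ^ 2 - 1)).
    { rewrite <- (sqrt_pow2 (a - 1)) by lra; apply sqrt_le_1; nra. }
    split; [|lra].
    apply Rle_trans with (2 := Hs).
    assert (Hp : 0 < 2 / a) by (apply Rdiv_lt_0_compat; lra).
    apply Rmult_le_reg_r with (1 + 2 / a); [lra|].
    replace (a / (1 + 2 / a) * (1 + 2 / a)) with a by (field; split; lra).
    replace ((a - 1) * (1 + 2 / a)) with (a + (a - 2) / a) by (field; lra).
    assert (0 <= (a - 2) / a) by (apply Rdiv_le_0_compat; lra). lra. }
  destruct (Hb a2 H2) as [U2 V2], (Hb a3 H3) as [U3 V3].
  set (b2 := sqrt (a2 ^ 2 - 1)) in *; set (b3 := sqrt (a3 ^ 2 - 1)) in *.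
  assert (P2 : 0 < 2 / a2) by (apply Rdiv_lt_0_compat; lra).
  assert (P3 : 0 < 2 / a3) by (apply Rdiv_lt_0_compat; lra).
  assert (Q : forall a b c, 0 < b -> 0 < c -> 0 < a -> a / c <= b -> a / b <= c).
  { intros a b c Hb' Hc' Ha' H.
    apply Rmult_le_reg_r with b; [easy|].
    replace (a / b * b) with a by (field; lra).
    apply Rmult_le_compat_r with (r := c) in H; [|lra].
    replace (a / c * c) with a in H by (field; lra). lra. }
  assert (X2 : a2 / b2 <= 1 + 2 / a2) by (apply Q; lra).
  assert (X3 : a3 / b3 <= 1 + 2 / a3) by (apply Q; lra).
  assert (Y2 : a2 / b2 <= 2) by (apply Q; lra).
  assert (Y3 : a3 / b3 <= 2) by (apply Q; lra).
  assert (Z2 : 0 <= a2 / b2) by (apply Rdiv_le_0_compat; lra).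
  assert (Z3 : 0 <= a3 / b3) by (apply Rdiv_le_0_compat; lra).
  replace ((a1 + a2 * a3) / (b2 * b3))
    with ((a2 / b2) * (a3 / b3) + (a2 / b2 * (a3 / b3)) * (a1 / (a2 * a3))) by (field; lra).
  assert (0 <= a1 / (a2 * a3)) by (apply Rdiv_le_0_compat; nra).
  apply Rplus_le_compat; [apply Rmult_le_compat; lra|].
  apply Rmult_le_compat_r; [easy|]. replace 4 with (2 * 2) by ring. apply Rmult_le_compat; lra.
Qed.

(** Near 1 the inverse hyperbolic cosine behaves like [sqrt (2 (x - 1))], so smallness [d] requires
    [x - 1] of order [d^2]. The root is at most [2 d] and [ln u <= u - 1] does the rest. *)
Lemma acosh_near_1 (x d : R) : 0 <= d <= 1 -> 1 <= x <= 1 + d ^ 2 -> acosh x <= 3 * d.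
Proof.
  intros Hd Hx; unfold acosh.
  assert (Hs : sqrt (x ^ 2 - 1) <= 2 * d).
  { assert (H : (x - 1) * (x + 1) <= d ^ 2 * 3) by (apply Rmult_le_compat; nra).
    assert (H' := pow2_ge_0 d).
    rewrite <- (sqrt_pow2 (2 * d)) by lra; apply sqrt_le_1; nra. }
  assert (Hp := acosh_arg_pos x (proj1 Hx)).
  assert (H := exp_ineq1_le (ln (x + sqrt (x ^ 2 - 1)))).
  rewrite exp_ln in H by lra. nra.
Qed.

(** * Derivatives of the hexagon sides and diagonal dominance *)

Lemma is_derive_acosh (f : R -> R) (t df : R) :
  is_derive f t df -> 1 < f t ->
  is_derive (fun s => acosh (f s)) t (df / sqrt (f t ^ 2 - 1)).
Proof.
  intros Hf H1.
  assert (Hq : 0 < f t ^ 2 - 1) by nra.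
  assert (Hs := sqrt_lt_R0 _ Hq).
  assert (Hac : is_derive acosh (f t) (/ sqrt (f t ^ 2 - 1))).
  { unfold acosh; auto_derive.
    - simpl in Hs, Hq; repeat split; try lra.
      replace (f t * (f t * 1) + - (1)) with (f t * (f t * 1) - 1) by ring; lra.
    - replace (f t * (f t * 1) + - (1)) with (f t ^ 2 - 1) by ring.
      set (q := sqrt (f t ^ 2 - 1)) in *; field; split; lra. }
  unfold Rdiv; now apply (is_derive_comp acosh f).
Qed.

(** The derivative of [acosh] contributes the product of the two roots divided by
    [sqrt (hex_disc ...)]; the product cancels against the denominator of the derivative of
    [hex_cosh]. *)
Lemma is_derive_hex_side (a1 a2 a3 : R -> R) (d1 d2 d3 t : R) :
  is_derive a1 t d1 -> is_derive a2 t d2 -> is_derive a3 t d3 ->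
  1 < a1 t -> 1 < a2 t -> 1 < a3 t ->
  is_derive (fun s => hex_side (a1 s) (a2 s) (a3 s)) t
    ((d1 - d2 * ((a3 t + a1 t * a2 t) / (a2 t ^ 2 - 1)) - d3 * ((a2 t + a1 t * a3 t) / (a3 t ^ 2 - 1)))
     / sqrt (hex_disc (a1 t) (a2 t) (a3 t))).
Proof.
  intros D1 D2 D3 H1 H2 H3.
  assert (HC := hex_cosh_sqr_minus1 _ _ _ H1 H2 H3).
  assert (HG := hex_cosh_gt1 _ _ _ H1 H2 H3).
  assert (HA := sqrt_lt_R0 _ (hex_disc_pos _ _ _ H1 H2 H3)).
  assert (HA' := Rlt_le _ _ (hex_disc_pos _ _ _ H1 H2 H3)).
  destruct (sqrt_sqr_minus1 _ H2) as [P2 [E2 _]], (sqrt_sqr_minus1 _ H3) as [P3 [E3 _]].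
  assert (DC : is_derive (fun s => hex_cosh (a1 s) (a2 s) (a3 s)) t
    ((d1 - d2 * ((a3 t + a1 t * a2 t) / (a2 t ^ 2 - 1)) - d3 * ((a2 t + a1 t * a3 t) / (a3 t ^ 2 - 1)))
     / (sqrt (a2 t ^ 2 - 1) * sqrt (a3 t ^ 2 - 1)))).
  { unfold hex_cosh; auto_derive.
    - repeat split; try (eexists; eassumption); simpl in *; try nra.
      apply Rgt_not_eq, Rmult_lt_0_compat; unfold Rminus in *; assumption.
    - replace (Derive (fun x => a1 x) t) with d1 by (symmetry; now apply is_derive_unique).
      replace (Derive (fun x => a2 x) t) with d2 by (symmetry; now apply is_derive_unique).
      replace (Derive (fun x => a3 x) t) with d3 by (symmetry; now apply is_derive_unique).
      replace (a2 t * (a2 t * 1) + - (1)) with (a2 t ^ 2 - 1) by ring.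
      replace (a3 t * (a3 t * 1) + - (1)) with (a3 t ^ 2 - 1) by ring.
      set (b2 := sqrt (a2 t ^ 2 - 1)) in *; set (b3 := sqrt (a3 t ^ 2 - 1)) in *.
      (* After multiplication by the cubes of both roots only their squares occur, and these are
         polynomials. *)
      apply Rmult_eq_reg_r with (b2 * b3 * (b2 * b2) * (b3 * b3));
        [|apply Rgt_not_eq; repeat apply Rmult_lt_0_compat; assumption].
      transitivity ((d1 + (d2 * a3 t + a2 t * d3)) * (b2 * b2) * (b3 * b3)
        - (a1 t + a2 t * a3 t) * (a2 t * d2 * (b3 * b3) + a3 t * d3 * (b2 * b2))).
      + field; lra.
      + rewrite E2, E3; field; nra. }
  evar_last; [apply is_derive_acosh; [exact DC|exact HG]|].
  assert (P : 0 < sqrt (a2 t ^ 2 - 1) * sqrt (a3 t ^ 2 - 1)) by now apply Rmult_lt_0_compat.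
  cbv beta; rewrite HC, sqrt_div_alt, sqrt_pow2; [|lra|now apply pow_lt].
  set (A := sqrt (hex_disc _ _ _)) in *.
  set (b2 := sqrt (a2 t ^ 2 - 1)) in *; set (b3 := sqrt (a3 t ^ 2 - 1)) in *.
  field; repeat split; nra.
Qed.

(** With [A] the root of [hex_disc], these are the terms of [- A / 2] times the quadratic form of
    the face Jacobian that belong to the two corners joined by edge 3: the diagonal contributions of
    that edge and the whole mixed term. *)
Definition pair_form (a1 a2 a3 x1 x2 : R) : R :=
  ((a2 + a1 * a3) * x1 ^ 2 + (a1 + a2 * a3) * x2 ^ 2 - 2 * (a3 - a1 - a2 - 1) * x1 * x2) / (a3 - 1).

(* Strict diagonal dominance: the diagonal entries exceed the off-diagonal one in absolute
   value by at least [4 (a3 - 1) / (a3 + 1)]. *)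
Lemma pair_form_ge (a1 a2 a3 x1 x2 : R) : 1 < a1 -> 1 < a2 -> 1 < a3 ->
  4 / (a3 + 1) * (x1 ^ 2 + x2 ^ 2) <= pair_form a1 a2 a3 x1 x2.
Proof.
  intros H1 H2 H3; unfold pair_form.
  apply Rle_trans with (4 / (a3 + 1) * (x1 ^ 2 + x2 ^ 2) * (a3 - 1) / (a3 - 1));
    [right; field; lra|].
  apply Rmult_le_compat_r; [apply Rlt_le, Rinv_0_lt_compat; lra|].
  set (m := 4 / (a3 + 1) * (a3 - 1)).
  replace (4 / (a3 + 1) * (x1 ^ 2 + x2 ^ 2) * (a3 - 1)) with (m * (x1 ^ 2 + x2 ^ 2))
    by (unfold m; field; lra).
  assert (Em : m * (a3 + 1) = 4 * (a3 - 1)) by (unfold m; field; lra).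
  (* The diagonal coefficient [a2 + a1 a3] minus [p] is [2 a2 + a1 (a3 + 1) - a3 + 1 > 4], and plus
     [p] it is [(a1 + 1) (a3 - 1) > 2 (a3 - 1)]. So [m] has to respect both 4 and [2 (a3 - 1)]; the
     other coefficient is symmetric. *)
  assert (m <= 4) by nra.
  assert (m <= 2 * (a3 - 1)) by nra.
  set (p := a3 - a1 - a2 - 1).
  assert (m + p <= a2 + a1 * a3) by (unfold p; nra).
  assert (m - p <= a2 + a1 * a3) by (unfold p; nra).
  assert (m + p <= a1 + a2 * a3) by (unfold p; nra).
  assert (m - p <= a1 + a2 * a3) by (unfold p; nra).
  assert (0 <= x1 ^ 2) by apply pow2_ge_0.
  assert (0 <= x2 ^ 2) by apply pow2_ge_0.
  assert (0 <= (x1 - x2) ^ 2) by apply pow2_ge_0.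
  assert (0 <= (x1 + x2) ^ 2) by apply pow2_ge_0.
  (* What is left after removing [m] is at least [|p| (x1 - x2)^2] or [|p| (x1 + x2)^2], according
     to the sign of [p]. *)
  destruct (Rle_or_lt 0 p); nra.
Qed.

(* [cosh l] as a function of [y = ln (cosh (l / 2))] *)
Definition edge_cosh (y : R) : R := 2 * exp (2 * y) - 1.

Lemma edge_cosh_gt1 (y : R) : 0 < y -> 1 < edge_cosh y.
Proof. intros H; unfold edge_cosh; assert (H' := exp_ineq1 (2 * y)); lra. Qed.

Lemma edge_cosh_bounds (y : R) : 0 < y -> exp (2 * y) <= edge_cosh y <= 2 * exp (2 * y).
Proof. intros H; unfold edge_cosh; assert (H' := exp_ineq1 (2 * y)); lra. Qed.

Lemma edge_cosh_ratio (y1 y2 y3 : R) : 0 < y1 -> 0 < y2 -> 0 < y3 ->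
  exp (2 * (y1 - y2 - y3)) / 4 <= edge_cosh y1 / (edge_cosh y2 * edge_cosh y3)
    <= 2 * exp (2 * (y1 - y2 - y3)).
Proof.
  intros H1 H2 H3.
  assert (B1 := edge_cosh_bounds y1 H1); assert (B2 := edge_cosh_bounds y2 H2);
    assert (B3 := edge_cosh_bounds y3 H3).
  replace (exp (2 * (y1 - y2 - y3))) with (exp (2 * y1) / (exp (2 * y2) * exp (2 * y3))).
  2: { rewrite <- exp_plus; unfold Rdiv; rewrite <- exp_Ropp, <- exp_plus; f_equal; ring. }
  assert (P1 := exp_pos (2 * y1)); assert (P2 := exp_pos (2 * y2)); assert (P3 := exp_pos (2 * y3)).
  set (e1 := exp (2 * y1)) in *; set (e2 := exp (2 * y2)) in *; set (e3 := exp (2 * y3)) in *.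
  set (a1 := edge_cosh y1) in *; set (a2 := edge_cosh y2) in *; set (a3 := edge_cosh y3) in *.
  split.
  - replace (e1 / (e2 * e3) / 4) with (e1 * / ((2 * e2) * (2 * e3))) by (field; lra).
    apply Rmult_le_compat; [lra|apply Rlt_le, Rinv_0_lt_compat; nra|lra|].
    apply Rinv_le_contravar; [nra|apply Rmult_le_compat; lra].
  - replace (2 * (e1 / (e2 * e3))) with ((2 * e1) * / (e2 * e3)) by (field; lra).
    apply Rmult_le_compat; [lra|apply Rlt_le, Rinv_0_lt_compat; nra|lra|].
    apply Rinv_le_contravar; [nra|apply Rmult_le_compat; lra].
Qed.

(** * What a bound on a hexagon side says about the edges, and conversely *)

Lemma hex_side_pos (a1 a2 a3 : R) : 1 < a1 -> 1 < a2 -> 1 < a3 -> 0 <= hex_side a1 a2 a3.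
Proof. intros; now apply acosh_pos, Rlt_le, hex_cosh_gt1. Qed.

Lemma hex_cosh_le_exp (a1 a2 a3 K : R) : 1 < a1 -> 1 < a2 -> 1 < a3 ->
  hex_side a1 a2 a3 <= K -> hex_cosh a1 a2 a3 <= exp K.
Proof.
  intros H1 H2 H3 H.
  apply Rle_trans with (exp (hex_side a1 a2 a3)).
  - now apply exp_acosh_ge, Rlt_le, hex_cosh_gt1.
  - destruct (Req_dec (hex_side a1 a2 a3) K) as [->|]; [lra|left; apply exp_increasing; lra].
Qed.

(** The cosine of the side is at least [a1 / (a2 a3)], which is at least a quarter of the
    exponential. For edge variables affine in [w] the left side is [-4 w_i] plus a constant, so this
    is a lower bound for the factor at the corner. *)
Lemma hex_side_bounded_ratio (y1 y2 y3 K : R) : 0 < y1 -> 0 < y2 -> 0 < y3 ->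
  hex_side (edge_cosh y1) (edge_cosh y2) (edge_cosh y3) <= K ->
  2 * (y1 - y2 - y3) <= K + ln 4.
Proof.
  intros H1 H2 H3 H.
  assert (HC := hex_cosh_le_exp _ _ _ _ (edge_cosh_gt1 _ H1) (edge_cosh_gt1 _ H2) (edge_cosh_gt1 _ H3) H).
  assert (HR := hex_cosh_ge_ratio _ _ _ (edge_cosh_gt1 _ H1) (edge_cosh_gt1 _ H2) (edge_cosh_gt1 _ H3)).
  destruct (edge_cosh_ratio y1 y2 y3 H1 H2 H3) as [HL _].
  apply Rnot_lt_le; intros C; apply exp_increasing in C.
  rewrite exp_plus, exp_ln in C by lra. lra.
Qed.

(** The side bound forces [sinh l >= exp (- K)] for the adjacent edge, that is
    [1 + exp (- 2 K) <= cosh^2 l]. Since [2 u - 1 <= u^2] for [u = exp (2 y)], the right side is at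
    most [exp (8 y)]; hence the divisor 8. *)
Lemma hex_side_bounded_nondegenerate (a1 a2 y K : R) : 1 < a1 -> 1 < a2 -> 0 < y ->
  hex_side a1 a2 (edge_cosh y) <= K -> ln (1 + exp (- (2 * K))) / 8 <= y.
Proof.
  intros H1 H2 Hy H.
  assert (H3 := edge_cosh_gt1 y Hy).
  assert (HC := hex_cosh_le_exp _ _ _ _ H1 H2 H3 H).
  assert (HR := hex_cosh_ge_inv _ _ _ H1 H2 H3).
  destruct (sqrt_sqr_minus1 _ H3) as [P [E _]].
  set (s := sqrt (edge_cosh y ^ 2 - 1)) in *.
  assert (Hs : exp (- K) <= s).
  { rewrite exp_Ropp, <- (Rinv_inv s). apply Rinv_le_contravar; [now apply Rinv_0_lt_compat|lra]. }
  assert (Hp := exp_pos (- K)).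
  assert (E2 : exp (- (2 * K)) = exp (- K) * exp (- K)) by (rewrite <- exp_plus; f_equal; ring).
  assert (H8 : exp (8 * y) = (exp (2 * y) * exp (2 * y)) ^ 2).
  { simpl; rewrite Rmult_1_r, <- !exp_plus; f_equal; ring. }
  assert (Hq : edge_cosh y <= exp (2 * y) * exp (2 * y)).
  { unfold edge_cosh; assert (0 <= (exp (2 * y) - 1) ^ 2) by apply pow2_ge_0; nra. }
  assert (Hle : 1 + exp (- (2 * K)) <= exp (8 * y)).
  { assert (edge_cosh y ^ 2 <= exp (8 * y)) by (rewrite H8; apply pow_incr; lra).
    rewrite E2; nra. }
  assert (Hpos : 0 < exp (- (2 * K))) by apply exp_pos.
  apply Rcomplements.ln_le in Hle; [|lra]. rewrite ln_exp in Hle. lra.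
Qed.

(** Two long adjacent edges and a small ratio push the cosine of the side to 1. With [d^2 / 16] the
    bound of [hex_cosh_le] becomes [(1 + d^2 / 8)^2 + d^2 / 2 <= 1 + d^2], as [acosh_near_1]
    requires. *)
Lemma hex_side_small (y1 y2 y3 d L : R) :
  0 < d <= 1 -> exp (- L) <= d ^ 2 / 16 ->
  0 < y1 -> L <= 2 * y2 -> L <= 2 * y3 -> 2 * (y1 - y2 - y3) <= - L ->
  hex_side (edge_cosh y1) (edge_cosh y2) (edge_cosh y3) <= 3 * d.
Proof.
  intros Hd HL H1 H2 H3 H4.
  assert (HL0 : 0 < L).
  { apply Rnot_le_lt; intros C. assert (H := exp_ineq1_le (- L)); nra. }
  assert (Hexp : forall u v, u <= v -> exp u <= exp v).
  { intros u v [Huv| ->]; [now left; apply exp_increasing|lra]. }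
  assert (Ha : forall y, L <= 2 * y -> 1 < edge_cosh y /\ 2 <= edge_cosh y /\ 2 / edge_cosh y <= 2 * (d ^ 2 / 16)).
  { intros y Hy; assert (Hy0 : 0 < y) by lra.
    assert (B := edge_cosh_bounds y Hy0).
    assert (Hi : exp (- (2 * y)) <= d ^ 2 / 16) by (apply Rle_trans with (2 := HL), Hexp; lra).
    assert (Hm : exp (2 * y) * exp (- (2 * y)) = 1) by (rewrite <- exp_plus, Rplus_opp_r; apply exp_0).
    assert (P := exp_pos (2 * y)); assert (P' := exp_pos (- (2 * y))).
    assert (2 <= exp (2 * y)) by nra.
    split; [lra|split; [lra|]].
    apply Rle_trans with (2 * exp (- (2 * y))); [|lra].
    rewrite exp_Ropp; apply Rmult_le_compat_l; [lra|apply Rinv_le_contravar; lra]. }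
  destruct (Ha y2 H2) as [A2 [B2 C2]], (Ha y3 H3) as [A3 [B3 C3]].
  assert (A1 := edge_cosh_gt1 y1 H1).
  apply acosh_near_1; [lra|split; [now apply Rlt_le, hex_cosh_gt1|]].
  apply Rle_trans with (1 := hex_cosh_le _ _ _ A1 B2 B3).
  destruct (edge_cosh_ratio y1 y2 y3) as [_ HR]; [easy|lra|lra|].
  assert (exp (2 * (y1 - y2 - y3)) <= d ^ 2 / 16) by (apply Rle_trans with (2 := HL), Hexp; lra).
  assert ((1 + 2 / edge_cosh y2) * (1 + 2 / edge_cosh y3)
          <= (1 + 2 * (d ^ 2 / 16)) * (1 + 2 * (d ^ 2 / 16))).
  { assert (0 <= 2 / edge_cosh y2) by (apply Rdiv_le_0_compat; lra).
    assert (0 <= 2 / edge_cosh y3) by (apply Rdiv_le_0_compat; lra).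
    apply Rmult_le_compat; lra. }
  assert (0 <= d ^ 2 <= 1) by nra. nra.
Qed.

Lemma hex_disc_le (a1 a2 a3 D : R) : 1 < a1 <= D -> 1 < a2 <= D -> 1 < a3 <= D ->
  sqrt (hex_disc a1 a2 a3) <= 3 * D ^ 2.
Proof.
  intros H1 H2 H3; assert (HP := hex_disc_pos a1 a2 a3 (proj1 H1) (proj1 H2) (proj1 H3)).
  rewrite <- (sqrt_pow2 (3 * D ^ 2)) by nra.
  assert (E1 : a1 ^ 2 <= D ^ 2) by (apply pow_incr; lra).
  assert (E2 : a2 ^ 2 <= D ^ 2) by (apply pow_incr; lra).
  assert (E3 : a3 ^ 2 <= D ^ 2) by (apply pow_incr; lra).
  assert (E : a1 * a2 * a3 <= D * D * D).
  { apply Rmult_le_compat; [nra|lra| |lra]. apply Rmult_le_compat; lra. }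
  apply sqrt_le_1; [lra|apply pow2_ge_0|].
  assert (1 <= D ^ 2) by nra.
  assert (D ^ 2 <= (D ^ 2) ^ 2) by nra.
  assert (D * D * D <= (D ^ 2) ^ 2) by nra.
  unfold hex_disc; nra.
Qed.

(** The product of [2 / (3 D^2)], from the bound on the root of [hex_disc], of [4 / (D + 1)], from
    [pair_form_ge], and of 2, because each corner takes part in two of the three pairs. *)
Definition dissipation (D : R) : R := 16 / (3 * D ^ 2 * (D + 1)).

Lemma dissipation_pos (D : R) : 1 <= D -> 0 < dissipation D.
Proof. intros H; unfold dissipation; apply Rdiv_lt_0_compat; nra. Qed.

(** When the factors move with velocities [g], the sum of the [g_k d_k] is the quadratic form of the
    face Jacobian at [g]. The common denominator lets it split into three pair forms, one for each
    edge. *)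
Lemma face_dissipation (y1 y2 y3 : R -> R) (g1 g2 g3 t D : R) :
  is_derive y1 t (g2 + g3) -> is_derive y2 t (g3 + g1) -> is_derive y3 t (g1 + g2) ->
  0 < y1 t -> 0 < y2 t -> 0 < y3 t ->
  edge_cosh (y1 t) <= D -> edge_cosh (y2 t) <= D -> edge_cosh (y3 t) <= D ->
  exists d1 d2 d3,
    is_derive (fun s => hex_side (edge_cosh (y1 s)) (edge_cosh (y2 s)) (edge_cosh (y3 s))) t d1 /\
    is_derive (fun s => hex_side (edge_cosh (y2 s)) (edge_cosh (y3 s)) (edge_cosh (y1 s))) t d2 /\
    is_derive (fun s => hex_side (edge_cosh (y3 s)) (edge_cosh (y1 s)) (edge_cosh (y2 s))) t d3 /\
    g1 * d1 + g2 * d2 + g3 * d3 <= - dissipation D * (g1 ^ 2 + g2 ^ 2 + g3 ^ 2).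
Proof.
  intros D1 D2 D3 P1 P2 P3 U1 U2 U3.
  assert (L1 := edge_cosh_gt1 _ P1); assert (L2 := edge_cosh_gt1 _ P2); assert (L3 := edge_cosh_gt1 _ P3).
  assert (Hd : forall y g, is_derive y t g ->
    is_derive (fun s => edge_cosh (y s)) t (2 * (edge_cosh (y t) + 1) * g)).
  { intros y g Hy; unfold edge_cosh; auto_derive; [now exists g|].
    replace (Derive (fun x => y x) t) with g by (symmetry; now apply is_derive_unique). ring. }
  apply Hd in D1, D2, D3.
  do 3 eexists; split; [exact (is_derive_hex_side _ _ _ _ _ _ t D1 D2 D3 L1 L2 L3)|].
  split; [exact (is_derive_hex_side _ _ _ _ _ _ t D2 D3 D1 L2 L3 L1)|].
  split; [exact (is_derive_hex_side _ _ _ _ _ _ t D3 D1 D2 L3 L1 L2)|]; cbv beta.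
  assert (Esym2 : hex_disc (edge_cosh (y2 t)) (edge_cosh (y3 t)) (edge_cosh (y1 t))
    = hex_disc (edge_cosh (y1 t)) (edge_cosh (y2 t)) (edge_cosh (y3 t))) by (unfold hex_disc; ring).
  assert (Esym3 : hex_disc (edge_cosh (y3 t)) (edge_cosh (y1 t)) (edge_cosh (y2 t))
    = hex_disc (edge_cosh (y1 t)) (edge_cosh (y2 t)) (edge_cosh (y3 t))) by (unfold hex_disc; ring).
  rewrite Esym2, Esym3.
  assert (HA := sqrt_lt_R0 _ (hex_disc_pos _ _ _ L1 L2 L3)).
  assert (HAD := hex_disc_le _ _ _ D (conj L1 U1) (conj L2 U2) (conj L3 U3)).
  set (A := sqrt _) in *.
  set (a1 := edge_cosh (y1 t)) in *; set (a2 := edge_cosh (y2 t)) in *; set (a3 := edge_cosh (y3 t)) in *.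
  transitivity (- (2 / A) * (pair_form a1 a2 a3 g1 g2 + pair_form a2 a3 a1 g2 g3 + pair_form a3 a1 a2 g3 g1)).
  { right; unfold pair_form; field; repeat split; nra. }
  assert (F1 := pair_form_ge a1 a2 a3 g1 g2 L1 L2 L3).
  assert (F2 := pair_form_ge a2 a3 a1 g2 g3 L2 L3 L1).
  assert (F3 := pair_form_ge a3 a1 a2 g3 g1 L3 L1 L2).
  assert (G1 := pow2_ge_0 g1); assert (G2 := pow2_ge_0 g2); assert (G3 := pow2_ge_0 g3).
  assert (Hc : forall a, 1 < a <= D -> 4 / (D + 1) <= 4 / (a + 1)).
  { intros a Ha; apply Rmult_le_compat_l; [lra|apply Rinv_le_contravar; lra]. }
  assert (C1 := Hc a1 (conj L1 U1)); assert (C2 := Hc a2 (conj L2 U2)); assert (C3 := Hc a3 (conj L3 U3)).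
  set (S := g1 ^ 2 + g2 ^ 2 + g3 ^ 2).
  assert (HF : 2 * (4 / (D + 1)) * S <= pair_form a1 a2 a3 g1 g2 + pair_form a2 a3 a1 g2 g3 + pair_form a3 a1 a2 g3 g1)
    by (unfold S; nra).
  set (PF := pair_form a1 a2 a3 g1 g2 + pair_form a2 a3 a1 g2 g3 + pair_form a3 a1 a2 g3 g1) in *.
  assert (HS : 0 <= S) by (unfold S; nra).
  assert (HA2 : 2 / (3 * D ^ 2) <= 2 / A) by (apply Rmult_le_compat_l; [lra|apply Rinv_le_contravar; lra]).
  assert (Hpos : 0 < 2 / (3 * D ^ 2)) by (apply Rdiv_lt_0_compat; nra).
  assert (Hpos' : 0 < 4 / (D + 1)) by (apply Rdiv_lt_0_compat; nra).
  assert (2 / (3 * D ^ 2) * (2 * (4 / (D + 1)) * S) <= 2 / A * PF) by (apply Rmult_le_compat; nra).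
  replace (dissipation D * S) with (2 / (3 * D ^ 2) * (2 * (4 / (D + 1)) * S)) by (unfold dissipation; field; nra).
  replace (- dissipation D * S) with (- (2 / (3 * D ^ 2) * (2 * (4 / (D + 1)) * S))) by (unfold dissipation; field; nra).
  lra.
Qed.

(** The filter is arbitrary because the limit is needed both at time 0 from the right and at
    infinity. *)
Lemma filterlim_hex_side (F : (R -> Prop) -> Prop) {FF : Filter F}
  (a1 a2 a3 : R -> R) (l1 l2 l3 : R) :
  1 < l1 -> 1 < l2 -> 1 < l3 ->
  filterlim a1 F (locally l1) -> filterlim a2 F (locally l2) -> filterlim a3 F (locally l3) ->
  filterlim (fun s => hex_side (a1 s) (a2 s) (a3 s)) F (locally (hex_side l1 l2 l3)).
Proof.
  intros H1 H2 H3 F1 F2 F3.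
  assert (Hm : forall f g x y, filterlim f F (locally x) -> filterlim g F (locally y) ->
    filterlim (fun s => f s * g s) F (locally (x * y))).
  { intros f g x y Hf Hg; apply (filterlim_comp_2 f g Rmult Hf Hg), (filterlim_mult (K := R_AbsRing)). }
  assert (Hb : forall f x, 1 < x -> filterlim f F (locally x) ->
    filterlim (fun s => sqrt (f s ^ 2 - 1)) F (locally (sqrt (x ^ 2 - 1)))).
  { intros f x Hx Hf; apply (filterlim_comp _ _ _ f (fun u => sqrt (u ^ 2 - 1)) F (locally x) _ Hf).
    apply (ex_derive_continuous (fun u => sqrt (u ^ 2 - 1)) x); auto_derive; simpl; nra. }
  destruct (sqrt_sqr_minus1 _ H2) as [P2 _], (sqrt_sqr_minus1 _ H3) as [P3 _].
  assert (HC := hex_cosh_gt1 _ _ _ H1 H2 H3).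
  assert (HF : filterlim (fun s => hex_cosh (a1 s) (a2 s) (a3 s)) F (locally (hex_cosh l1 l2 l3))).
  { unfold hex_cosh, Rdiv; apply Hm.
    - apply (filterlim_comp_2 a1 (fun s => a2 s * a3 s) Rplus F1 (Hm _ _ _ _ F2 F3)).
      apply (filterlim_plus (V := R_NormedModule)).
    - apply (filterlim_comp _ _ _ (fun s => sqrt (a2 s ^ 2 - 1) * sqrt (a3 s ^ 2 - 1)) Rinv F
              (locally (sqrt (l2 ^ 2 - 1) * sqrt (l3 ^ 2 - 1)))).
      + now apply Hm; apply Hb.
      + apply (ex_derive_continuous Rinv); auto_derive; nra. }
  apply (filterlim_comp _ _ _ (fun s => hex_cosh (a1 s) (a2 s) (a3 s)) acosh F _ _ HF).
  apply (ex_derive_continuous acosh); eexists.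
  apply (is_derive_acosh (fun x => x) _ 1); [apply (is_derive_id (K := R_AbsRing))|exact HC].
Qed.

(** * Bounded Lipschitz functions *)

Definition clip (M x : R) : R := Rmax (- M) (Rmin M x).

Section BoundedLipschitz.

Variable n : nat.

(** Boundedness is included since it makes the class closed under products. One constant serves as
    bound and as Lipschitz constant for the maximum norm of the first [n] coordinates. *)
Definition lip_bound (c : R) (f : (nat -> R) -> R) : Prop :=
  0 <= c /\ (forall x, Rabs (f x) <= c) /\
  forall x y d, 0 <= d -> (forall i, (i < n)%nat -> Rabs (x i - y i) <= d) ->
    Rabs (f x - f y) <= c * d.

Definition bounded_lip (f : (nat -> R) -> R) : Prop := exists c, lip_bound c f.

Lemma lip_bound_mono (c c' : R) (f : (nat -> R) -> R) : c <= c' -> lip_bound c f -> lip_bound c' f.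
Proof.
  intros Hc [H0 [H1 H2]]; split; [lra|split].
  - intros x; apply Rle_trans with (1 := H1 x); lra.
  - intros x y d Hd H; apply Rle_trans with (1 := H2 x y d Hd H). now apply Rmult_le_compat_r.
Qed.

Lemma bounded_lip_const (a : R) : bounded_lip (fun _ => a).
Proof.
  exists (Rabs a); split; [apply Rabs_pos|split; [intros; lra|]].
  intros x y d Hd _; rewrite Rminus_diag, Rabs_R0; apply Rmult_le_pos; [apply Rabs_pos|easy].
Qed.

Lemma bounded_lip_plus (f g : (nat -> R) -> R) :
  bounded_lip f -> bounded_lip g -> bounded_lip (fun x => f x + g x).
Proof.
  intros [c [Hc [B L]]] [c' [Hc' [B' L']]]; exists (c + c'); split; [lra|split].
  - intros x; apply Rle_trans with (1 := Rabs_triang _ _); specialize (B x); specialize (B' x); lra.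
  - intros x y d Hd H; replace (f x + g x - (f y + g y)) with ((f x - f y) + (g x - g y)) by ring.
    apply Rle_trans with (1 := Rabs_triang _ _).
    specialize (L x y d Hd H); specialize (L' x y d Hd H); lra.
Qed.

Lemma bounded_lip_mult (f g : (nat -> R) -> R) :
  bounded_lip f -> bounded_lip g -> bounded_lip (fun x => f x * g x).
Proof.
  intros [c [Hc [B L]]] [c' [Hc' [B' L']]]; exists (2 * c * c'); assert (Hcc : 0 <= c * c') by nra.
  split; [lra|split].
  - intros x; rewrite Rabs_mult. specialize (B x); specialize (B' x).
    assert (Rabs (f x) * Rabs (g x) <= c * c') by (apply Rmult_le_compat; try apply Rabs_pos; lra). lra.
  - intros x y d Hd H; replace (f x * g x - f y * g y) with ((f x - f y) * g x + f y * (g x - g y)) by ring.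
    apply Rle_trans with (1 := Rabs_triang _ _); rewrite !Rabs_mult.
    specialize (L x y d Hd H); specialize (L' x y d Hd H); specialize (B y); specialize (B' x).
    assert (Rabs (f x - f y) * Rabs (g x) <= (c * d) * c') by (apply Rmult_le_compat; try apply Rabs_pos; lra).
    assert (Rabs (f y) * Rabs (g x - g y) <= c * (c' * d)) by (apply Rmult_le_compat; try apply Rabs_pos; lra).
    lra.
Qed.

Lemma bounded_lip_lsum {A : Type} (f : A -> (nat -> R) -> R) (l : list A) :
  (forall a, In a l -> bounded_lip (f a)) -> bounded_lip (fun x => lsum (fun a => f a x) l).
Proof.
  induction l as [|a l IH]; intros H; [exact (bounded_lip_const 0)|].
  apply (bounded_lip_plus (f a) (fun x => lsum (fun a => f a x) l)).
  - apply H; now left.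
  - apply IH; intros; apply H; now right.
Qed.

Lemma bounded_lip_comp (f : (nat -> R) -> R) (p : R -> R) (a k : R) :
  0 <= k -> bounded_lip f -> (forall x, a <= f x) ->
  (forall u v, a <= u -> a <= v -> Rabs (p u - p v) <= k * Rabs (u - v)) ->
  bounded_lip (fun x => p (f x)).
Proof.
  intros Hk [c [Hc [B L]]] Ha Hp.
  (* The values of [f] differ by at most [2 c], so those of [p] along [f] stay within [2 k c] of the
     value at the zero point. *)
  exists (Rabs (p (f (fun _ => 0))) + 2 * k * c).
  assert (Hkc : 0 <= k * c) by nra. assert (HP := Rabs_pos (p (f (fun _ => 0)))).
  split; [lra|split].
  - intros x.
    replace (p (f x)) with (p (f (fun _ => 0)) + (p (f x) - p (f (fun _ => 0)))) by ring.
    apply Rle_trans with (1 := Rabs_triang _ _).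
    assert (H1 := Hp _ _ (Ha x) (Ha (fun _ => 0))).
    assert (H2 : Rabs (f x - f (fun _ => 0)) <= 2 * c).
    { apply Rle_trans with (1 := Rabs_triang _ _); rewrite Rabs_Ropp.
      assert (H3 := B x); assert (H4 := B (fun _ => 0)); lra. }
    nra.
  - intros x y d Hd H1.
    assert (H2 := Hp _ _ (Ha x) (Ha y)). assert (H3 := L x y d Hd H1).
    assert (k * Rabs (f x - f y) <= k * (c * d)) by now apply Rmult_le_compat_l. nra.
Qed.

Lemma bounded_lip_max (f : (nat -> R) -> R) (a : R) :
  bounded_lip f -> bounded_lip (fun x => Rmax a (f x)).
Proof.
  intros [c Hf].
  apply (bounded_lip_comp f (Rmax a) (- c) 1); [lra|now exists c| |].
  - intros x; destruct Hf as [_ [B _]]; assert (H := Rabs_le_between (f x) c).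
    destruct (proj1 H (B x)); lra.
  - intros u v _ _; unfold Rmax; destruct (Rle_dec a u), (Rle_dec a v); unfold Rabs; repeat destruct Rcase_abs; lra.
Qed.

Lemma bounded_lip_clip (M : R) (i : nat) :
  0 <= M -> (i < n)%nat -> bounded_lip (fun x => clip M (x i)).
Proof.
  unfold clip.
  intros HM Hi; exists (M + 1); split; [lra|split].
  - intros x; unfold Rmax, Rmin; repeat destruct Rle_dec; unfold Rabs; destruct Rcase_abs; lra.
  - intros x y d Hd H; specialize (H i Hi).
    apply Rle_trans with (1 * d); [|apply Rmult_le_compat_r; lra].
    rewrite Rmult_1_l; apply Rle_trans with (2 := H).
    unfold Rmax, Rmin; repeat destruct Rle_dec; unfold Rabs; repeat destruct Rcase_abs; lra.
Qed.

Lemma lipschitz_of_derive_bound (p dp : R -> R) (k u v : R) :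
  (forall s, Rmin u v <= s <= Rmax u v -> is_derive p s (dp s)) ->
  (forall s, Rmin u v <= s <= Rmax u v -> Rabs (dp s) <= k) ->
  Rabs (p u - p v) <= k * Rabs (u - v).
Proof.
  intros Hd Hb.
  destruct (MVT_gen p u v dp) as [c [Hc E]].
  - intros s Hs; apply Hd; lra.
  - intros s Hs; apply continuity_pt_filterlim, (ex_derive_continuous p); exists (dp s); now apply Hd.
  - rewrite Rabs_minus_sym, E, Rabs_mult, (Rabs_minus_sym u v).
    apply Rmult_le_compat_r; [apply Rabs_pos|now apply Hb].
Qed.

Lemma bounded_lip_smooth (f : (nat -> R) -> R) (p dp : R -> R) (a k : R) :
  0 <= k -> bounded_lip f -> (forall x, a <= f x) ->
  (forall u, a <= u -> is_derive p u (dp u)) -> (forall u, a <= u -> Rabs (dp u) <= k) ->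
  bounded_lip (fun x => p (f x)).
Proof.
  intros Hk Hf Ha Hd Hb; apply (bounded_lip_comp f p a k); try easy.
  intros u v Hu Hv; apply lipschitz_of_derive_bound with dp; intros s [Hs _];
    (assert (Hs' : a <= s); [apply Rle_trans with (2 := Hs); now apply Rmin_glb|]); auto.
Qed.

Lemma bounded_lip_exp (f : (nat -> R) -> R) : bounded_lip f -> bounded_lip (fun x => exp (f x)).
Proof.
  intros [c Hf]; destruct (Hf) as [Hc [B _]].
  assert (Hle : forall x, - f x >= - c).
  { intros x; assert (H := Rabs_le_between (f x) c); destruct (proj1 H (B x)); lra. }
  (* [exp] is not globally Lipschitz; pass through the map that is capped at [c] *)
  destruct (bounded_lip_comp f (fun u => exp (Rmin u c)) (- c) (exp c)) as [c' Hc'].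
  - apply Rlt_le, exp_pos.
  - now exists c.
  - intros x; assert (H := Rabs_le_between (f x) c); destruct (proj1 H (B x)); lra.
  - intros u v _ _. apply Rle_trans with (exp c * Rabs (Rmin u c - Rmin v c)).
    + apply lipschitz_of_derive_bound with exp; intros s Hs; [apply is_derive_exp|].
      rewrite Rabs_pos_eq by (apply Rlt_le, exp_pos).
      assert (Hsc : s <= c).
      { apply Rle_trans with (1 := proj2 Hs); apply Rmax_lub; apply Rmin_r. }
      destruct Hsc as [Hsc| ->]; [now left; apply exp_increasing|lra].
    + apply Rmult_le_compat_l; [apply Rlt_le, exp_pos|].
      unfold Rmin; destruct (Rle_dec u c), (Rle_dec v c); unfold Rabs; repeat destruct Rcase_abs; lra.
  - exists c'; destruct Hc' as [H1 [H2 H3]].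
    assert (E : forall x, exp (Rmin (f x) c) = exp (f x)).
    { intros x; rewrite Rmin_left; [easy|specialize (Hle x); lra]. }
    split; [easy|split].
    + intros x; rewrite <- E; apply H2.
    + intros x y d Hd H; rewrite <- !E; now apply H3.
Qed.

Lemma bounded_lip_inv (f : (nat -> R) -> R) (a : R) :
  0 < a -> bounded_lip f -> (forall x, a <= f x) -> bounded_lip (fun x => / f x).
Proof.
  intros Ha Hf H; apply (bounded_lip_smooth f Rinv (fun u => - / (u ^ 2)) a (/ a ^ 2)); try easy.
  - apply Rlt_le, Rinv_0_lt_compat; nra.
  - intros u Hu; auto_derive; [lra|field; lra].
  - intros u Hu; rewrite Rabs_Ropp, Rabs_pos_eq by (apply Rlt_le, Rinv_0_lt_compat; nra).
    apply Rinv_le_contravar; [nra|apply pow_incr; lra].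
Qed.

Lemma bounded_lip_ln (f : (nat -> R) -> R) (a : R) :
  0 < a -> bounded_lip f -> (forall x, a <= f x) -> bounded_lip (fun x => ln (f x)).
Proof.
  intros Ha Hf H; apply (bounded_lip_smooth f ln (fun u => / u) a (/ a)); try easy.
  - now apply Rlt_le, Rinv_0_lt_compat.
  - intros u Hu; apply is_derive_ln; lra.
  - intros u Hu; rewrite Rabs_pos_eq by (apply Rlt_le, Rinv_0_lt_compat; lra).
    apply Rinv_le_contravar; lra.
Qed.

Lemma bounded_lip_sqrt (f : (nat -> R) -> R) (a : R) :
  0 < a -> bounded_lip f -> (forall x, a <= f x) -> bounded_lip (fun x => sqrt (f x)).
Proof.
  intros Ha Hf H; assert (Hs := sqrt_lt_R0 a Ha).
  apply (bounded_lip_smooth f sqrt (fun u => / (2 * sqrt u)) a (/ (2 * sqrt a))); try easy.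
  - apply Rlt_le, Rinv_0_lt_compat; lra.
  - intros u Hu; auto_derive; [lra|].
    assert (H' := sqrt_lt_R0 u ltac:(lra)); field; lra.
  - intros u Hu; assert (sqrt a <= sqrt u) by (apply sqrt_le_1; lra).
    rewrite Rabs_pos_eq by (apply Rlt_le, Rinv_0_lt_compat; lra).
    apply Rinv_le_contravar; lra.
Qed.

(** The slope of [acosh] is infinite at 1, so the argument must keep a distance [d] from 1. *)
Lemma bounded_lip_acosh (f : (nat -> R) -> R) (d : R) :
  0 < d -> bounded_lip f -> (forall x, 1 + d <= f x) -> bounded_lip (fun x => acosh (f x)).
Proof.
  intros Hd Hf H; unfold acosh.
  apply bounded_lip_ln with 1; [lra| |].
  - apply bounded_lip_plus; [easy|].
    apply bounded_lip_sqrt with d; [easy| |].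
    + unfold Rminus; apply bounded_lip_plus; [|apply bounded_lip_const].
      simpl; repeat apply bounded_lip_mult; easy || apply bounded_lip_const.
    + intros x; specialize (H x); nra.
  - intros x; apply acosh_arg_pos; specialize (H x); lra.
Qed.

(** The distance of [hex_cosh] from 1 is at least the inverse of the product of the two roots,
    because [a1 >= 1] and [a2 a3] dominates that product. An upper bound [c] for the product gives
    the gap [1 / (c + 1)]. *)
Lemma bounded_lip_hex_side (a1 a2 a3 : (nat -> R) -> R) (d : R) :
  0 < d -> bounded_lip a1 -> bounded_lip a2 -> bounded_lip a3 ->
  (forall x, 1 + d <= a1 x) -> (forall x, 1 + d <= a2 x) -> (forall x, 1 + d <= a3 x) ->
  bounded_lip (fun x => hex_side (a1 x) (a2 x) (a3 x)).
Proof.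
  intros Hd L1 L2 L3 H1 H2 H3.
  assert (Hs : forall a, bounded_lip a -> (forall x, 1 + d <= a x) ->
    bounded_lip (fun x => sqrt (a x ^ 2 - 1)) /\ forall x, sqrt d <= sqrt (a x ^ 2 - 1)).
  { intros a La Ha; assert (Hle : forall x, d <= a x ^ 2 - 1) by (intros x; specialize (Ha x); nra).
    split.
    - apply bounded_lip_sqrt with d; [easy| |easy].
      unfold Rminus; apply bounded_lip_plus; [|apply bounded_lip_const].
      simpl; repeat apply bounded_lip_mult; easy || apply bounded_lip_const.
    - intros x; specialize (Hle x); apply sqrt_le_1; lra. }
  destruct (Hs a2 L2 H2) as [S2 P2], (Hs a3 L3 H3) as [S3 P3].
  assert (Hsd := sqrt_lt_R0 d Hd).
  assert (Hprod : forall x, sqrt d * sqrt d <= sqrt (a2 x ^ 2 - 1) * sqrt (a3 x ^ 2 - 1)).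
  { intros x; specialize (P2 x); specialize (P3 x); apply Rmult_le_compat; lra. }
  assert (Lprod := bounded_lip_mult _ _ S2 S3).
  destruct (Lprod) as [c [Hc [Bc _]]].
  unfold hex_side; apply bounded_lip_acosh with (/ (c + 1)); [apply Rinv_0_lt_compat; lra| |].
  - unfold hex_cosh, Rdiv; apply bounded_lip_mult.
    + apply bounded_lip_plus; [easy|now apply bounded_lip_mult].
    + now apply bounded_lip_inv with (sqrt d * sqrt d); [nra| |].
  - intros x; unfold hex_cosh.
    specialize (H1 x); specialize (H2 x); specialize (H3 x); specialize (Bc x).
    destruct (sqrt_sqr_minus1 (a2 x) ltac:(lra)) as [Q2 [_ U2]], (sqrt_sqr_minus1 (a3 x) ltac:(lra)) as [Q3 [_ U3]].
    set (b2 := sqrt (a2 x ^ 2 - 1)) in *; set (b3 := sqrt (a3 x ^ 2 - 1)) in *.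
    assert (Hb : 0 < b2 * b3) by now apply Rmult_lt_0_compat.
    rewrite Rabs_pos_eq in Bc by lra.
    apply Rle_trans with (1 + / (b2 * b3)).
    + apply Rplus_le_compat_l, Rinv_le_contravar; lra.
    + replace (1 + / (b2 * b3)) with ((1 + b2 * b3) * / (b2 * b3)) by (field; lra).
      apply Rmult_le_compat_r; [now apply Rlt_le, Rinv_0_lt_compat|].
      assert (b2 * b3 <= a2 x * a3 x) by (apply Rmult_le_compat; lra). lra.
Qed.

Lemma lip_bound_uniform (f : nat -> (nat -> R) -> R) (m : nat) :
  (forall i, (i < m)%nat -> bounded_lip (f i)) ->
  exists c, 0 < c /\ forall i, (i < m)%nat -> lip_bound c (f i).
Proof.
  induction m as [|m IH]; intros H; [exists 1; split; [lra|lia]|].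
  destruct IH as [c [Hc IH]]; [intros; apply H; lia|].
  destruct (H m) as [c' Hc']; [lia|].
  exists (Rmax c c'); split; [apply Rlt_le_trans with (1 := Hc), Rmax_l|].
  intros i Hi; destruct (Nat.eq_dec i m) as [->|].
  - apply lip_bound_mono with (2 := Hc'); apply Rmax_r.
  - apply lip_bound_mono with c; [apply Rmax_l|apply IH; lia].
Qed.

End BoundedLipschitz.

(** * The flow *)

Definition corners (T : tri_data) : list (nat * nat) := list_prod (seq 0 (nF T)) (seq 0 3).

Lemma in_corners (T : tri_data) (f k : nat) :
  In (f, k) (corners T) <-> (f < nF T)%nat /\ (k < 3)%nat.
Proof. unfold corners; rewrite in_prod_iff, !in_seq; lia. Qed.

Lemma nxt_lt (k : nat) : (nxt k < 3)%nat.
Proof. apply Nat.mod_upper_bound; lia. Qed.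

Lemma nxt3 (k : nat) : (k < 3)%nat -> nxt (nxt (nxt k)) = k.
Proof. destruct k as [|[|[|k]]]; [easy..|lia]. Qed.

(* [log_cosh_half T l0 w e] is the logarithm of [cosh (l e / 2)] for [l = w * l0]; it is
   affine in [w], and admissibility says exactly that it is positive. *)
Definition edge_const (l0 : nat -> R) (e : nat) : R := ln (cosh (l0 e / 2)).
Definition log_cosh_half (T : tri_data) (l0 w : nat -> R) (e : nat) : R :=
  w (esrc T e) + w (etgt T e) + edge_const l0 e.

Definition corner_side (T : tri_data) (y : nat -> R) (f k : nat) : R :=
  hex_side (edge_cosh (y (fe T f k))) (edge_cosh (y (fe T f (nxt k))))
    (edge_cosh (y (fe T f (nxt (nxt k))))).

Definition boundary_length (T : tri_data) (y : nat -> R) (i : nat) : R :=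
  lsum (fun p => if Nat.eqb (fv T (fst p) (snd p)) i then corner_side T y (fst p) (snd p) else 0)
    (corners T).

Lemma cosh_ge_1 (x : R) : 1 <= cosh x.
Proof.
  unfold cosh; assert (H1 := exp_ineq1_le x); assert (H2 := exp_ineq1_le (- x)); lra.
Qed.

Lemma edge_const_pos (l0 : nat -> R) (e : nat) : 0 <= edge_const l0 e.
Proof. unfold edge_const; rewrite <- ln_1; apply Rcomplements.ln_le; [lra|apply cosh_ge_1]. Qed.

Section Surface.

Variables (T : tri_data) (l0 b : nat -> R).
Hypothesis HT : closed_surface_triangulation T.
Hypothesis Hb : forall i, (i < nV T)%nat -> 0 < b i.

Let n := nV T.

Lemma edge_endpoints (e : nat) : (e < nE T)%nat -> (esrc T e < n)%nat /\ (etgt T e < n)%nat.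
Proof. apply HT. Qed.

Lemma corner_vertex (f k : nat) : (f < nF T)%nat -> (k < 3)%nat -> (fv T f k < n)%nat.
Proof. intros Hf Hk; destruct HT as [_ [H _]]; apply (H f k Hf Hk). Qed.

Lemma face_edge (f k : nat) : (f < nF T)%nat -> (k < 3)%nat -> (fe T f k < nE T)%nat.
Proof. intros Hf Hk; destruct HT as [_ [H _]]; apply (H f k Hf Hk). Qed.

Lemma log_cosh_half_corner (w : nat -> R) (f k : nat) : (f < nF T)%nat -> (k < 3)%nat ->
  log_cosh_half T l0 w (fe T f k)
  = w (fv T f (nxt k)) + w (fv T f (nxt (nxt k))) + edge_const l0 (fe T f k).
Proof.
  intros Hf Hk; destruct HT as [_ [H _]]; destruct (H f k Hf Hk) as [_ [_ Ho]].
  unfold log_cosh_half; destruct (fo T f k); destruct Ho as [-> ->]; ring.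
Qed.

Lemma edge_in_face (e : nat) : (e < nE T)%nat ->
  exists f k, (f < nF T)%nat /\ (k < 3)%nat /\ fe T f k = e.
Proof.
  intros He; destruct HT as [_ [_ [H _]]]; specialize (H e He); unfold edge_multiplicity in H.
  destruct (filter _ _) as [|[f k] l] eqn:E; [easy|].
  assert (Hin : In (f, k) ((f, k) :: l)) by now left.
  rewrite <- E in Hin; apply filter_In in Hin; destruct Hin as [Hin Heq].
  apply in_corners in Hin; apply Nat.eqb_eq in Heq. now exists f, k.
Qed.

Lemma vertex_in_face (v : nat) : (v < n)%nat ->
  exists f k, (f < nF T)%nat /\ (k < 3)%nat /\ fv T f k = v.
Proof. destruct HT as [_ [_ [_ [H _]]]]; apply H. Qed.

Definition edges_positive (y : nat -> R) : Prop := forall e, (e < nE T)%nat -> 0 < y e.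

Lemma admissible_iff (w : nat -> R) :
  admissible T l0 w <-> edges_positive (log_cosh_half T l0 w).
Proof.
  split; intros H e He; specialize (H e He); unfold log_cosh_half, edge_const in *; lra.
Qed.

(** Double-angle formulas at [exp y], where [2 (exp y)^2 - 1] is [edge_cosh y]. They turn [theta]
    into [hex_side] of the edge variables. *)
Lemma cosh_conf_metric (w : nat -> R) (e : nat) :
  0 < log_cosh_half T l0 w e ->
  cosh (conf_metric T l0 w e) = edge_cosh (log_cosh_half T l0 w e) /\
  sinh (conf_metric T l0 w e) = sqrt (edge_cosh (log_cosh_half T l0 w e) ^ 2 - 1).
Proof.
  intros H; unfold conf_metric.
  assert (E : exp (w (esrc T e) + w (etgt T e)) * cosh (l0 e / 2) = exp (log_cosh_half T l0 w e)).
  { unfold log_cosh_half, edge_const; rewrite (exp_plus (_ + _)), exp_ln; [easy|].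
    assert (H' := cosh_ge_1 (l0 e / 2)); lra. }
  rewrite E; set (y := log_cosh_half T l0 w e) in *.
  assert (H1 := exp_ineq1_le y).
  rewrite cosh_double_acosh, sinh_double_acosh by lra.
  assert (E2 : 2 * exp y ^ 2 - 1 = edge_cosh y).
  { unfold edge_cosh; replace (2 * y) with (y + y) by ring; rewrite exp_plus; ring. }
  now rewrite E2.
Qed.

Lemma Blen_boundary_length (w : nat -> R) (i : nat) : admissible T l0 w ->
  Blen T l0 w i = boundary_length T (log_cosh_half T l0 w) i.
Proof.
  intros Hw; apply admissible_iff in Hw; apply (lsum_ext _ _ (corners T)).
  intros [f k] Hp; apply in_corners in Hp; destruct Hp as [Hf Hk]; simpl.
  destruct (Nat.eqb _ _); [|easy].
  unfold theta, corner_side, hex_side, hex_cosh; f_equal.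
  assert (H : forall j, (j < 3)%nat -> 0 < log_cosh_half T l0 w (fe T f j))
    by (intros; apply Hw; now apply face_edge).
  destruct (cosh_conf_metric w _ (H k Hk)) as [-> _].
  destruct (cosh_conf_metric w _ (H _ (nxt_lt k))) as [-> ->].
  destruct (cosh_conf_metric w _ (H _ (nxt_lt (nxt k)))) as [-> ->]. reflexivity.
Qed.

Lemma corner_side_pos (y : nat -> R) (f k : nat) :
  edges_positive y -> (f < nF T)%nat -> (k < 3)%nat -> 0 <= corner_side T y f k.
Proof.
  intros Hy Hf Hk; apply hex_side_pos; apply edge_cosh_gt1, Hy, face_edge; try easy; apply nxt_lt.
Qed.

Lemma corner_side_le_boundary_length (y : nat -> R) (f k : nat) :
  edges_positive y -> (f < nF T)%nat -> (k < 3)%nat ->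
  corner_side T y f k <= boundary_length T y (fv T f k).
Proof.
  intros Hy Hf Hk.
  apply Rle_trans with ((fun p => if Nat.eqb (fv T (fst p) (snd p)) (fv T f k)
     then corner_side T y (fst p) (snd p) else 0) (f, k)).
  - simpl; rewrite Nat.eqb_refl; lra.
  - apply (lsum_ge_term (fun p => if Nat.eqb (fv T (fst p) (snd p)) (fv T f k)
     then corner_side T y (fst p) (snd p) else 0)).
    + intros [f' k'] Hp; apply in_corners in Hp; simpl; destruct (Nat.eqb _ _); [|lra].
      now apply corner_side_pos.
    + now apply in_corners.
Qed.

Lemma filterlim_log_cosh_half (F : (R -> Prop) -> Prop) {FF : Filter F}
  (w : R -> nat -> R) (x : nat -> R) (e : nat) :
  (forall i, (i < n)%nat -> filterlim (fun t => w t i) F (locally (x i))) ->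
  (e < nE T)%nat ->
  filterlim (fun t => log_cosh_half T l0 (w t) e) F (locally (log_cosh_half T l0 x e)).
Proof.
  intros Hw He; destruct (edge_endpoints e He) as [Hs Ht]; unfold log_cosh_half.
  apply (filterlim_comp_2 (fun t => w t (esrc T e) + w t (etgt T e)) (fun _ => edge_const l0 e) Rplus
           (G := locally (x (esrc T e) + x (etgt T e))) (H := locally (edge_const l0 e))).
  - apply (filterlim_comp_2 (fun t => w t (esrc T e)) (fun t => w t (etgt T e)) Rplus (Hw _ Hs) (Hw _ Ht)).
    apply (filterlim_plus (V := R_NormedModule)).
  - apply filterlim_const.
  - apply (filterlim_plus (V := R_NormedModule)).
Qed.

Lemma filterlim_boundary_length (F : (R -> Prop) -> Prop) {FF : Filter F}
  (w : R -> nat -> R) (x : nat -> R) (i : nat) :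
  (forall i, (i < n)%nat -> filterlim (fun t => w t i) F (locally (x i))) ->
  edges_positive (log_cosh_half T l0 x) ->
  filterlim (fun t => boundary_length T (log_cosh_half T l0 (w t)) i) F
    (locally (boundary_length T (log_cosh_half T l0 x) i)).
Proof.
  intros Hw Hx; unfold boundary_length.
  apply (filterlim_lsum F
    (fun p t => if Nat.eqb (fv T (fst p) (snd p)) i
                then corner_side T (log_cosh_half T l0 (w t)) (fst p) (snd p) else 0)).
  intros [f k] Hp; apply in_corners in Hp; destruct Hp as [Hf Hk]; simpl.
  destruct (Nat.eqb _ _); [|apply filterlim_const].
  assert (Hc : forall j, (j < 3)%nat ->
    1 < edge_cosh (log_cosh_half T l0 x (fe T f j)) /\
    filterlim (fun t => edge_cosh (log_cosh_half T l0 (w t) (fe T f j))) F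
      (locally (edge_cosh (log_cosh_half T l0 x (fe T f j))))).
  { intros j Hj; split; [exact (edge_cosh_gt1 _ (Hx _ (face_edge f j Hf Hj)))|].
    apply (filterlim_comp _ _ _ (fun t => log_cosh_half T l0 (w t) (fe T f j)) edge_cosh F
             (locally (log_cosh_half T l0 x (fe T f j)))).
    - exact (filterlim_log_cosh_half F w x _ Hw (face_edge f j Hf Hj)).
    - apply (ex_derive_continuous edge_cosh); unfold edge_cosh; auto_derive; easy. }
  destruct (Hc k Hk), (Hc _ (nxt_lt k)), (Hc _ (nxt_lt (nxt k))).
  now apply filterlim_hex_side.
Qed.

(** * The energy and its dissipation along the flow *)

Definition energy (w : nat -> R) : R :=
  lsum (fun i => (boundary_length T (log_cosh_half T l0 w) i - b i) ^ 2) (seq 0 n).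

Lemma energy_ge_term (w : nat -> R) (i : nat) : (i < n)%nat ->
  (boundary_length T (log_cosh_half T l0 w) i - b i) ^ 2 <= energy w.
Proof.
  intros Hi; apply (lsum_ge_term (fun i => (boundary_length T (log_cosh_half T l0 w) i - b i) ^ 2)).
  - intros; apply pow2_ge_0.
  - apply in_seq; lia.
Qed.

Lemma energy_pos (w : nat -> R) : 0 <= energy w.
Proof. apply lsum_ge0; intros; apply pow2_ge_0. Qed.

Lemma filterlim_energy (F : (R -> Prop) -> Prop) {FF : Filter F}
  (w : R -> nat -> R) (x : nat -> R) :
  (forall i, (i < n)%nat -> filterlim (fun t => w t i) F (locally (x i))) ->
  edges_positive (log_cosh_half T l0 x) ->
  filterlim (fun t => energy (w t)) F (locally (energy x)).
Proof.
  intros Hw Hx; unfold energy.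
  apply (filterlim_lsum F (fun i t => (boundary_length T (log_cosh_half T l0 (w t)) i - b i) ^ 2)).
  intros i _.
  apply (filterlim_comp _ _ _ _ (fun u => (u - b i) ^ 2) F _ _ (filterlim_boundary_length F w x i Hw Hx)).
  apply (ex_derive_continuous (fun u => (u - b i) ^ 2)); auto_derive; easy.
Qed.

(** Exchanging the sums regroups a sum over vertices into one over corners, which can then be
    estimated face by face. *)
Lemma lsum_corners_vertex (h : nat -> R) (c : nat * nat -> R) :
  lsum (fun i => h i * lsum (fun p => if Nat.eqb (fv T (fst p) (snd p)) i then c p else 0) (corners T))
    (seq 0 n)
  = lsum (fun p => h (fv T (fst p) (snd p)) * c p) (corners T).
Proof.
  rewrite (lsum_ext _ (fun i => lsum (fun p =>
    if Nat.eqb (fv T (fst p) (snd p)) i then h i * c p else 0) (corners T))).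
  2: { intros i _; rewrite <- lsum_scal; apply lsum_ext; intros p _; destruct (Nat.eqb _ _); ring. }
  rewrite lsum_exchange; apply lsum_ext; intros [f k] Hp; apply in_corners in Hp; simpl.
  apply (lsum_delta (fun i => h i * c (f, k))); now apply corner_vertex.
Qed.

(** Every vertex occurs at some corner, so the face estimates together control the full energy. *)
Lemma lsum_vertices_le_corners (h : nat -> R) :
  (forall i, 0 <= h i) ->
  lsum h (seq 0 n) <= lsum (fun p => h (fv T (fst p) (snd p))) (corners T).
Proof.
  intros Hh.
  rewrite (lsum_ext _ (fun p => h (fv T (fst p) (snd p)) * 1)) by (intros; ring).
  rewrite <- (lsum_corners_vertex h (fun _ => 1)).
  apply lsum_le; intros i Hi; apply in_seq in Hi.
  rewrite <- (Rmult_1_r (h i)) at 1; apply Rmult_le_compat_l; [easy|].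
  destruct (vertex_in_face i) as [f [k [Hf [Hk E]]]]; [lia|].
  apply Rle_trans with ((fun p => if Nat.eqb (fv T (fst p) (snd p)) i then 1 else 0) (f, k)).
  - simpl; rewrite E, Nat.eqb_refl; lra.
  - apply (lsum_ge_term (fun p => if Nat.eqb (fv T (fst p) (snd p)) i then 1 else 0)).
    + intros p _; destruct (Nat.eqb _ _); lra.
    + now apply in_corners.
Qed.

Lemma lsum_corners_faces (c : nat -> nat -> R) :
  lsum (fun p => c (fst p) (snd p)) (corners T)
  = lsum (fun f => c f 0%nat + c f 1%nat + c f 2%nat) (seq 0 (nF T)).
Proof.
  unfold corners; rewrite lsum_list_prod; apply lsum_ext; intros f _.
  unfold lsum; simpl; ring.
Qed.

(** The derivative is twice the sum of the quadratic forms of all faces at the speed vector. The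
    bound [D] is needed at the time [t] only, which permits a use before uniform bounds are
    known. *)
Lemma energy_dissipation (w : R -> nat -> R) (t D : R) :
  1 <= D ->
  edges_positive (log_cosh_half T l0 (w t)) ->
  (forall e, (e < nE T)%nat -> edge_cosh (log_cosh_half T l0 (w t) e) <= D) ->
  (forall i, (i < n)%nat -> is_derive (fun s => w s i) t
     (boundary_length T (log_cosh_half T l0 (w t)) i - b i)) ->
  exists dE, is_derive (fun s => energy (w s)) t dE /\ dE <= - (2 * dissipation D) * energy (w t).
Proof.
  intros HD1 Hpos HD Hw.
  set (g := fun i => boundary_length T (log_cosh_half T l0 (w t)) i - b i).
  (* [face_dissipation] yields its derivatives separately for each face; [Derive] gathers them into
     one function that can be summed. *)
  set (c := fun f k => Derive (fun s => corner_side T (log_cosh_half T l0 (w s)) f k) t).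
  assert (Hface : forall f, (f < nF T)%nat ->
    (forall k, (k < 3)%nat ->
      is_derive (fun s => corner_side T (log_cosh_half T l0 (w s)) f k) t (c f k)) /\
    g (fv T f 0%nat) * c f 0%nat + g (fv T f 1%nat) * c f 1%nat + g (fv T f 2%nat) * c f 2%nat
    <= - dissipation D * (g (fv T f 0%nat) ^ 2 + g (fv T f 1%nat) ^ 2 + g (fv T f 2%nat) ^ 2)).
  { intros f Hf.
    assert (Hy : forall k, (k < 3)%nat ->
      is_derive (fun s => log_cosh_half T l0 (w s) (fe T f k)) t
        (g (fv T f (nxt k)) + g (fv T f (nxt (nxt k))))).
    { intros k Hk.
      apply (is_derive_ext (fun s => w s (fv T f (nxt k)) + w s (fv T f (nxt (nxt k))) + edge_const l0 (fe T f k))).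
      - intros s; symmetry; now apply log_cosh_half_corner.
      - rewrite <- (Rplus_0_r (_ + _)).
        apply (is_derive_plus (V := R_NormedModule)
                 (fun s => w s (fv T f (nxt k)) + w s (fv T f (nxt (nxt k)))) (fun _ => edge_const l0 (fe T f k)));
          [|apply (is_derive_const (V := R_NormedModule))].
        apply (is_derive_plus (V := R_NormedModule) (fun s => w s (fv T f (nxt k)))
          (fun s => w s (fv T f (nxt (nxt k))))); apply Hw, corner_vertex; try easy; apply nxt_lt. }
    assert (L0 : (0 < 3)%nat) by lia; assert (L1 : (1 < 3)%nat) by lia; assert (L2 : (2 < 3)%nat) by lia.
    destruct (face_dissipation
      (fun s => log_cosh_half T l0 (w s) (fe T f 0%nat)) (fun s => log_cosh_half T l0 (w s) (fe T f 1%nat))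
      (fun s => log_cosh_half T l0 (w s) (fe T f 2%nat))
      (g (fv T f 0%nat)) (g (fv T f 1%nat)) (g (fv T f 2%nat)) t D
      (Hy 0%nat L0) (Hy 1%nat L1) (Hy 2%nat L2)) as [d0 [d1 [d2 [E0 [E1 [E2 Hd]]]]]];
      try (now apply Hpos, face_edge); try (now apply HD, face_edge).
    assert (C0 : c f 0%nat = d0) by exact (is_derive_unique _ _ _ E0).
    assert (C1 : c f 1%nat = d1) by exact (is_derive_unique _ _ _ E1).
    assert (C2 : c f 2%nat = d2) by exact (is_derive_unique _ _ _ E2).
    split; [|now rewrite C0, C1, C2].
    intros [|[|[|k]]] Hk; [rewrite C0; exact E0|rewrite C1; exact E1|rewrite C2; exact E2|lia]. }
  exists (lsum (fun i => 2 * g i *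
    lsum (fun p => if Nat.eqb (fv T (fst p) (snd p)) i then c (fst p) (snd p) else 0) (corners T)) (seq 0 n)).
  split.
  - unfold energy.
    apply (is_derive_lsum (fun i s => (boundary_length T (log_cosh_half T l0 (w s)) i - b i) ^ 2)).
    intros i _.
    assert (HB : is_derive (fun s => boundary_length T (log_cosh_half T l0 (w s)) i) t
      (lsum (fun p => if Nat.eqb (fv T (fst p) (snd p)) i then c (fst p) (snd p) else 0) (corners T))).
    { unfold boundary_length.
      apply (is_derive_lsum (fun p s => if Nat.eqb (fv T (fst p) (snd p)) i
        then corner_side T (log_cosh_half T l0 (w s)) (fst p) (snd p) else 0)).
      intros [f k] Hp; apply in_corners in Hp; simpl; destruct (Nat.eqb _ _).
      - now apply Hface.
      - apply (is_derive_const (V := R_NormedModule)). }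
    rewrite Rmult_comm.
    apply (is_derive_comp (fun u => (u - b i) ^ 2) _ t (2 * g i) _); [|exact HB].
    unfold g; auto_derive; [easy|ring].
  - rewrite (lsum_corners_vertex (fun i => 2 * g i) (fun p => c (fst p) (snd p))).
    rewrite (lsum_corners_faces (fun f k => 2 * g (fv T f k) * c f k)).
    assert (HE : energy (w t) <= lsum (fun f => g (fv T f 0%nat) ^ 2 + g (fv T f 1%nat) ^ 2 + g (fv T f 2%nat) ^ 2)
                    (seq 0 (nF T))).
    { apply Rle_trans with (1 := lsum_vertices_le_corners (fun i => g i ^ 2) (fun i => pow2_ge_0 (g i))).
      right; apply (lsum_corners_faces (fun f k => g (fv T f k) ^ 2)). }
    apply Rle_trans with (lsum (fun f => - (2 * dissipation D) *
       (g (fv T f 0%nat) ^ 2 + g (fv T f 1%nat) ^ 2 + g (fv T f 2%nat) ^ 2)) (seq 0 (nF T))).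
    + apply lsum_le; intros f Hf; apply in_seq in Hf.
      destruct (Hface f) as [_ H]; [lia|]. lra.
    + rewrite lsum_scal; assert (Hdp := dissipation_pos D HD1). nra.
Qed.

(** The interval is open and time 0 enters through a right limit, so both a given solution and an
    initial piece of the truncated flow fit. *)
Definition flow_on (w0 : nat -> R) (tau : R) (w : R -> nat -> R) : Prop :=
  (forall i, (i < n)%nat -> filterlim (fun t => w t i) (at_right 0) (locally (w0 i))) /\
  (forall t, 0 < t < tau -> edges_positive (log_cosh_half T l0 (w t))) /\
  (forall i t, (i < n)%nat -> 0 < t < tau ->
     is_derive (fun s => w s i) t (boundary_length T (log_cosh_half T l0 (w t)) i - b i)).

Definition in_region (eps M : R) (w : nat -> R) : Prop :=
  (forall e, (e < nE T)%nat -> eps <= log_cosh_half T l0 w e) /\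
  (forall i, (i < n)%nat -> - M <= w i <= M).

Lemma energy_decr (w0 : nat -> R) (tau : R) (w : R -> nat -> R) :
  edges_positive (log_cosh_half T l0 w0) -> flow_on w0 tau w ->
  forall t, 0 < t < tau -> energy (w t) <= energy w0.
Proof.
  intros Hw0 [Hlim [Hpos Hder]].
  assert (Hd : forall t, 0 < t < tau -> exists dE, is_derive (fun s => energy (w s)) t dE /\ dE <= 0).
  { intros t Ht.
    (* No bound on the edges uniform in time exists yet, so [D] depends on [t]; this yields
       monotonicity without a rate. *)
    destruct (finite_upper_bound (fun e => edge_cosh (log_cosh_half T l0 (w t) e)) (nE T)) as [D [HD0 HD]].
    destruct (energy_dissipation w t (D + 1)) as [dE [HdE Hle]]; [lra|now apply Hpos| | |].
    - intros e He; specialize (HD e He); simpl in HD; lra.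
    - intros i Hi; now apply Hder.
    - exists dE; split; [easy|]; assert (H := energy_pos (w t)).
      assert (H' := dissipation_pos (D + 1)); nra. }
  apply (derive_nonpos_decr0 (fun s => energy (w s)) (Derive (fun s => energy (w s))) tau).
  - now apply filterlim_energy; [apply at_right_proper_filter| |].
  - intros t Ht; destruct (Hd t Ht) as [dE [HdE _]]; apply Derive_correct; now exists dE.
  - intros t Ht; destruct (Hd t Ht) as [dE [HdE Hle]]; now replace (Derive (fun s => energy (w s)) t) with dE
      by (symmetry; now apply is_derive_unique).
Qed.

(** * A priori bounds *)

Lemma energy_bound_corner_side (E : R) :
  exists K, forall w, edges_positive (log_cosh_half T l0 w) -> energy w <= E ->
    forall f k, (f < nF T)%nat -> (k < 3)%nat -> corner_side T (log_cosh_half T l0 w) f k <= K.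
Proof.
  destruct (finite_upper_bound b n) as [B [HB0 HB]].
  (* From [u <= 1 + u^2] applied to the excess [u] of a boundary length over [b]. *)
  exists (B + 1 + E); intros w Hw HE f k Hf Hk.
  assert (Hv := corner_vertex f k Hf Hk).
  apply Rle_trans with (1 := corner_side_le_boundary_length _ f k Hw Hf Hk).
  assert (H := energy_ge_term w _ Hv); specialize (HB _ Hv).
  set (u := boundary_length _ _ _ - _) in *.
  assert (u <= 1 + u ^ 2) by nra. unfold u in *; lra.
Qed.

Lemma corner_side_bound_region (K : R) :
  exists eps M, 0 < eps /\ forall w, edges_positive (log_cosh_half T l0 w) ->
    (forall f k, (f < nF T)%nat -> (k < 3)%nat -> corner_side T (log_cosh_half T l0 w) f k <= K) ->
    (forall e, (e < nE T)%nat -> eps <= log_cosh_half T l0 w e) /\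
    (forall i, (i < n)%nat -> - M <= w i).
Proof.
  destruct (finite_upper_bound (edge_const l0) (nE T)) as [C [HC0 HC]].
  (* The first constant is that of [hex_side_bounded_nondegenerate]. The second comes from
     [-4 w_i <= K + ln 4 + 4 C], with [C] bounding the two edge constants of negative sign. *)
  exists (ln (1 + exp (- (2 * K))) / 8), ((K + ln 4 + 4 * C) / 4); split.
  { assert (H := exp_pos (- (2 * K))).
    assert (0 < ln (1 + exp (- (2 * K)))) by (rewrite <- ln_1; apply ln_increasing; lra). lra. }
  intros w Hw HK; split.
  - intros e He; destruct (edge_in_face e He) as [f [k [Hf [Hk Ee]]]].
    (* At the corner [nxt k] the edge [fe T f k] is the third argument of [hex_side], the one that
       [hex_side_bounded_nondegenerate] controls. *)
    specialize (HK f (nxt k) Hf (nxt_lt k)); unfold corner_side in HK; rewrite (nxt3 k Hk), Ee in HK.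
    apply hex_side_bounded_nondegenerate with (4 := HK); [..|now apply Hw];
      apply edge_cosh_gt1, Hw, face_edge; easy || apply nxt_lt.
  - intros i Hi; destruct (vertex_in_face i Hi) as [f [k [Hf [Hk Ei]]]].
    specialize (HK f k Hf Hk); unfold corner_side in HK.
    assert (E0 := face_edge f k Hf Hk); assert (E1 := face_edge f (nxt k) Hf (nxt_lt k));
      assert (E2 := face_edge f (nxt (nxt k)) Hf (nxt_lt (nxt k))).
    apply hex_side_bounded_ratio in HK; [|now apply Hw ..].
    rewrite !log_cosh_half_corner, !(nxt3 k Hk), Ei in HK by (easy || apply nxt_lt).
    assert (B1 := HC _ E1); assert (B2 := HC _ E2); assert (B0 := edge_const_pos l0 (fe T f k)).
    lra.
Qed.

(* A corner at a vertex with large conformal factor is short, whatever the factors at the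
   other vertices, as long as these are bounded below. *)
Lemma large_factor_short_boundary (M0 : R) :
  exists M, forall w, edges_positive (log_cosh_half T l0 w) ->
    (forall i, (i < n)%nat -> - M0 <= w i) ->
    forall i, (i < n)%nat -> M < w i -> boundary_length T (log_cosh_half T l0 w) i <= b i.
Proof.
  destruct (finite_upper_bound (edge_const l0) (nE T)) as [C [HC0 HC]].
  destruct (finite_pos_lower_bound b n Hb) as [m [Hm Hmb]].
  set (N := INR (length (corners T))).
  assert (HN : 0 <= N) by apply pos_INR.
  (* At most [N] corners of side at most [3 d] then add up to at most [m], the lower bound of all
     [b i]. *)
  set (d := m / (3 * (N + 1))).
  assert (Hd : 0 < d <= 1).
  { unfold d; split; [apply Rdiv_lt_0_compat; lra|].
    apply Rmult_le_reg_r with (3 * (N + 1)); [lra|].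
    replace (m / (3 * (N + 1)) * (3 * (N + 1))) with m by (field; lra). lra. }
  set (L := - ln (d ^ 2 / 16)).
  assert (HL : exp (- L) <= d ^ 2 / 16) by (unfold L; rewrite Ropp_involutive, exp_ln; [lra|nra]).
  assert (HL0 : 0 < L).
  { apply Rnot_le_lt; intros H. assert (H' := exp_ineq1_le (- L)); nra. }
  (* Beyond this threshold both adjacent edge variables exceed [L], and the exponent [-4 w_i + 2 C]
     lies below [- L]. *)
  exists (Rabs M0 + C + L); intros w Hw HM0 i Hi Hlarge.
  assert (HM0' := Rle_abs M0); assert (HM0'' := Rabs_pos M0).
  apply Rle_trans with (lsum (fun _ => 3 * d) (corners T)).
  - apply lsum_le; intros [f k] Hp; apply in_corners in Hp; destruct Hp as [Hf Hk]; simpl.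
    destruct (Nat.eqb_spec (fv T f k) i) as [Ei|]; [|lra].
    assert (E0 := face_edge f k Hf Hk); assert (E1 := face_edge f (nxt k) Hf (nxt_lt k));
      assert (E2 := face_edge f (nxt (nxt k)) Hf (nxt_lt (nxt k))).
    assert (V1 := HM0 _ (corner_vertex f _ Hf (nxt_lt k)));
      assert (V2 := HM0 _ (corner_vertex f _ Hf (nxt_lt (nxt k)))).
    assert (B0 := HC _ E0); assert (P1 := edge_const_pos l0 (fe T f (nxt k)));
      assert (P2 := edge_const_pos l0 (fe T f (nxt (nxt k)))).
    apply hex_side_small with L; try easy; [now apply Hw|..];
      rewrite !log_cosh_half_corner, ?(nxt3 k Hk), ?Ei by (easy || apply nxt_lt); lra.
  - rewrite lsum_const; fold N; apply Rle_trans with (2 := Hmb i Hi).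
    replace m with ((N + 1) * (3 * d)) at 1 by (unfold d; field; lra). nra.
Qed.

(** The constants are chosen before [tau] and [w]. This uniformity lets the existence proof extend
    the time interval by a fixed amount again and again. *)
Lemma a_priori_region (w0 : nat -> R) : edges_positive (log_cosh_half T l0 w0) ->
  exists eps M, 0 < eps /\ 0 <= M /\ in_region eps M w0 /\
    forall tau w, flow_on w0 tau w -> forall t, 0 < t < tau -> in_region eps M (w t).
Proof.
  intros Hw0.
  destruct (energy_bound_corner_side (energy w0)) as [K HK].
  destruct (corner_side_bound_region K) as [eps [M0 [Heps HM0]]].
  destruct (large_factor_short_boundary M0) as [M1 HM1].
  destruct (finite_upper_bound w0 n) as [M2 [HM2 Hw0M]].
  set (M := Rmax (Rabs M0) (Rmax M1 M2)).
  assert (H0 : Rabs M0 <= M) by apply Rmax_l.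
  assert (H1 : Rmax M1 M2 <= M) by apply Rmax_r.
  assert (H0' := Rle_abs M0).
  exists eps, M; split; [easy|]; split; [assert (H := Rabs_pos M0); lra|]; split.
  - destruct (HM0 w0 Hw0 (HK w0 Hw0 (Rle_refl _))) as [Ha Hc].
    split; [easy|]; intros i Hi; specialize (Hc i Hi); specialize (Hw0M i Hi).
    assert (H2 := Rmax_r M1 M2); lra.
  - intros tau w Hflow.
    assert (HE := energy_decr w0 tau w Hw0 Hflow).
    destruct Hflow as [Hlim [Hpos Hder]].
    assert (Hlow : forall t, 0 < t < tau -> (forall e, (e < nE T)%nat -> eps <= log_cosh_half T l0 (w t) e) /\
        (forall i, (i < n)%nat -> - M0 <= w t i)).
    { intros t Ht; apply HM0; [now apply Hpos|]; apply HK; [now apply Hpos|now apply HE]. }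
    intros t Ht; split; [now apply Hlow|]; intros i Hi; split.
    + destruct (Hlow t Ht) as [_ H]; specialize (H i Hi); lra.
    + apply Rle_trans with (2 := H1).
      (* The lower bounds come before this step because a large factor yields a short boundary only
         when the other factors are bounded below. *)
      apply (barrier (fun s => w s i) (fun s => boundary_length T (log_cosh_half T l0 (w s)) i - b i)
               (Rmax M1 M2) (w0 i) tau); try easy.
      * apply Rle_trans with (1 := Hw0M i Hi), Rmax_r.
      * now apply Hlim.
      * intros s Hs; now apply Hder.
      * intros s Hs Hlarge; assert (H2 := Rmax_l M1 M2).
        assert (H := HM1 (w s) (Hpos s Hs) (proj2 (Hlow s Hs)) i Hi ltac:(lra)). lra.
Qed.

(** * Truncation of the field and global existence *)

Definition truncated_edge (eps M : R) (w : nat -> R) (e : nat) : R :=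
  Rmax eps (clip M (w (esrc T e)) + clip M (w (etgt T e)) + edge_const l0 e).

Lemma boundary_length_ext (y y' : nat -> R) (i : nat) :
  (forall e, (e < nE T)%nat -> y e = y' e) -> boundary_length T y i = boundary_length T y' i.
Proof.
  intros H; apply lsum_ext; intros [f k] Hp; apply in_corners in Hp; destruct Hp as [Hf Hk]; simpl.
  destruct (Nat.eqb _ _); [|easy]; unfold corner_side.
  now rewrite !H by (apply face_edge; easy || apply nxt_lt).
Qed.

Lemma truncated_edge_region (eps M : R) (w : nat -> R) (e : nat) :
  in_region eps M w -> (e < nE T)%nat -> truncated_edge eps M w e = log_cosh_half T l0 w e.
Proof.
  intros [He Hi] Hlt; destruct (edge_endpoints e Hlt) as [Hs Ht].
  apply Hi in Hs, Ht; specialize (He e Hlt); unfold truncated_edge, clip.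
  now rewrite !(Rmin_right M), !(Rmax_right (- M)), Rmax_right by (lra || exact He).
Qed.

(** Clipping bounds the edge variables from above and the maximum with [eps] keeps every hyperbolic
    cosine at least [1 + eps], away from the singularities of the hexagon formula. *)
Lemma bounded_lip_truncated_field (eps M : R) (i : nat) : 0 < eps -> 0 <= M ->
  bounded_lip n (fun w => boundary_length T (truncated_edge eps M w) i - b i).
Proof.
  intros Heps HM; apply bounded_lip_plus; [|apply bounded_lip_const].
  unfold boundary_length; apply (bounded_lip_lsum n (fun p w =>
    if Nat.eqb (fv T (fst p) (snd p)) i then corner_side T (truncated_edge eps M w) (fst p) (snd p) else 0)).
  intros [f k] Hp; apply in_corners in Hp; destruct Hp as [Hf Hk]; simpl.
  destruct (Nat.eqb _ _); [|apply bounded_lip_const].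
  assert (Hc : forall j, (j < 3)%nat ->
    bounded_lip n (fun w => edge_cosh (truncated_edge eps M w (fe T f j))) /\
    forall w, 1 + eps <= edge_cosh (truncated_edge eps M w (fe T f j))).
  { intros j Hj; destruct (edge_endpoints _ (face_edge f j Hf Hj)) as [Hs Ht]; split.
    - unfold edge_cosh, Rminus.
      apply bounded_lip_plus; [|apply bounded_lip_const].
      apply bounded_lip_mult; [apply bounded_lip_const|].
      apply bounded_lip_exp, bounded_lip_mult; [apply bounded_lip_const|].
      unfold truncated_edge; apply bounded_lip_max.
      apply bounded_lip_plus; [|apply bounded_lip_const].
      apply bounded_lip_plus; now apply bounded_lip_clip.
    - intros w; assert (H := Rmax_l eps (clip M (w (esrc T (fe T f j))) + clip M (w (etgt T (fe T f j)))
        + edge_const l0 (fe T f j))).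
      fold (truncated_edge eps M w (fe T f j)) in H.
      assert (H' := exp_ineq1_le (2 * truncated_edge eps M w (fe T f j))); unfold edge_cosh; lra. }
  destruct (Hc k Hk), (Hc _ (nxt_lt k)), (Hc _ (nxt_lt (nxt k))).
  unfold corner_side; now apply bounded_lip_hex_side with eps.
Qed.

Lemma lipschitz_right_limit (f : R -> R) (c : R) :
  (forall t, Rabs (f t - f 0) <= c * Rabs (t - 0)) -> filterlim f (at_right 0) (locally (f 0)).
Proof.
  intros H; apply filterlim_locally; intros eps.
  assert (Hc := Rabs_pos c); assert (He := cond_pos eps); assert (Hca := Rle_abs c).
  assert (Hd : 0 < eps / (Rabs c + 1)) by (apply Rdiv_lt_0_compat; lra).
  exists (mkposreal _ Hd); intros s Hs _; change (Rabs (s - 0) < eps / (Rabs c + 1)) in Hs.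
  change (Rabs (f s - f 0) < eps); apply Rle_lt_trans with (1 := H s).
  assert (Hs0 := Rabs_pos (s - 0)).
  apply Rmult_lt_compat_r with (r := Rabs c + 1) in Hs; [|lra].
  replace (eps / (Rabs c + 1) * (Rabs c + 1)) with (pos eps) in Hs by (field; lra). nra.
Qed.

(* The truncated field is globally Lipschitz, and its solution moves with bounded speed.  The
   a priori region lies well inside the region where the truncation is inactive, so the solution
   needs at least a fixed time to leave the latter; stepping by this time shows it never does. *)
Lemma flow_exists (w0 : nat -> R) : edges_positive (log_cosh_half T l0 w0) ->
  exists w, (forall i, (i < n)%nat -> w 0 i = w0 i) /\
    (forall t, 0 <= t -> edges_positive (log_cosh_half T l0 (w t))) /\
    forall tau, flow_on w0 tau w.
Proof.
  intros Hw0; destruct (a_priori_region w0 Hw0) as [eps [M [Heps [HM [Hreg0 Hreg]]]]].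
  set (V := fun w i => boundary_length T (truncated_edge (eps / 2) (M + 1) w) i - b i).
  destruct (lip_bound_uniform n (fun i w => V w i) n) as [c [Hc HV]].
  { intros i _; apply bounded_lip_truncated_field; lra. }
  destruct (picard_lindelof_global n V c c w0) as [w [H0 [Hlip Hder]]]; try lra.
  { intros x i Hi; now apply HV. }
  { intros x y d Hd i Hi; apply HV; try easy. apply Rle_trans with (2 := Hd i Hi), Rabs_pos. }
  exists w.
  (* During [dt] each factor moves by at most [eps / 4] and by at most 1. An edge variable contains
     two factors, so it loses at most [eps / 2], exactly the margin of the truncation. *)
  set (dt := Rmin (eps / 4) 1 / c).
  assert (Hm : 0 < Rmin (eps / 4) 1) by (apply Rmin_glb_lt; lra).
  assert (Hdt : 0 < dt) by now apply Rdiv_lt_0_compat.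
  assert (Hcdt : c * dt <= eps / 4 /\ c * dt <= 1).
  { unfold dt; replace (c * (Rmin (eps / 4) 1 / c)) with (Rmin (eps / 4) 1) by (field; lra).
    split; [apply Rmin_l|apply Rmin_r]. }
  assert (Hlim : forall i, (i < n)%nat -> filterlim (fun t => w t i) (at_right 0) (locally (w0 i))).
  { intros i Hi; rewrite <- (H0 i Hi); apply lipschitz_right_limit with c; intros t; now apply Hlip. }
  assert (Hext : forall x y, (forall i, (i < n)%nat -> x i = y i) -> in_region eps M x -> in_region eps M y).
  { intros x y E [R1 R2]; split.
    - intros e He; destruct (edge_endpoints e He) as [Hs Ht].
      specialize (R1 e He); unfold log_cosh_half in *; now rewrite (E _ Hs), (E _ Ht) in R1.
    - intros i Hi; rewrite <- (E i Hi); now apply R2. }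
  assert (Hstart : in_region eps M (w 0)) by (apply Hext with (2 := Hreg0); intros; now rewrite H0).
  assert (Hnear : forall s t, Rabs (t - s) <= dt -> in_region eps M (w s) -> in_region (eps / 2) (M + 1) (w t)).
  { intros s t Hst [R1 R2].
    assert (Hd : forall i, (i < n)%nat -> - (c * dt) <= w t i - w s i <= c * dt).
    { intros i Hi; apply Rabs_le_between, Rle_trans with (1 := Hlip s t i Hi).
      apply Rmult_le_compat_l; lra. }
    split.
    - intros e He; destruct (edge_endpoints e He) as [Hs Ht].
      specialize (R1 e He); apply Hd in Hs, Ht; unfold log_cosh_half in *; lra.
    - intros i Hi; specialize (R2 i Hi); specialize (Hd i Hi); lra. }
  assert (Hinactive : forall tau, (forall t, 0 < t < tau -> in_region (eps / 2) (M + 1) (w t)) -> flow_on w0 tau w).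
  { intros tau Ht; split; [easy|split].
    - intros t Htt e He; destruct (Ht t Htt) as [R1 _]; specialize (R1 e He); lra.
    - intros i t Hi Htt.
      rewrite <- (boundary_length_ext (truncated_edge (eps / 2) (M + 1) (w t))).
      + apply Hder; [easy|lra].
      + intros e He; apply truncated_edge_region; [now apply Ht|easy]. }
  (* [Hnear] gives the larger region on the next piece of length [dt]; there the truncation is
     inactive, and [Hreg] returns the smaller region on the whole longer interval. *)
  assert (Hstep : forall N t, 0 < t < INR N * dt -> in_region eps M (w t)).
  { induction N as [|N IH]; [simpl; intros; lra|].
    apply Hreg, Hinactive; intros t Ht; rewrite S_INR in Ht.
    destruct (Rle_or_lt t dt) as [Htd|Htd].
    - apply Hnear with 0; [rewrite Rabs_pos_eq; lra|easy].
    - apply Hnear with (t - dt); [rewrite Rabs_pos_eq; lra|apply IH; lra]. }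
  assert (Hall : forall t, 0 <= t -> in_region eps M (w t)).
  { intros t [Ht|<-]; [|easy].
    destruct (nfloor_ex (t / dt)) as [N HN]; [apply Rdiv_le_0_compat; lra|].
    apply (Hstep (S N)); split; [easy|]; rewrite S_INR.
    destruct HN as [_ HN]; apply Rmult_lt_compat_r with (r := dt) in HN; [|easy].
    now replace (t / dt * dt) with t in HN by (field; lra). }
  split; [easy|split].
  - intros t Ht e He; destruct (Hall t Ht) as [R1 _]; specialize (R1 e He); lra.
  - intros tau; apply Hinactive; intros t Ht.
    destruct (Hall t) as [R1 R2]; [lra|]; split.
    + intros e He; specialize (R1 e He); lra.
    + intros i Hi; specialize (R2 i Hi); lra.
Qed.

(** * Convergence of the flow *)

Lemma is_lim_unique_limit (f : R -> R) (l : R) : is_lim f p_infty l -> real (Lim f p_infty) = l.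
Proof. intros H; now rewrite (is_lim_unique f p_infty l H). Qed.

(** The speed is integrable, so a limit exists; it satisfies [B = b] since the speed tends to 0 and
    the boundary lengths are continuous at the limit. *)
Lemma flow_converges (w0 : nat -> R) (w : R -> nat -> R) :
  edges_positive (log_cosh_half T l0 w0) -> (forall tau, flow_on w0 tau w) ->
  exists x, edges_positive (log_cosh_half T l0 x) /\
    (forall i, (i < n)%nat -> boundary_length T (log_cosh_half T l0 x) i = b i) /\
    exists C lam, 0 < C /\ 0 < lam /\
      (forall i t, (i < n)%nat -> 0 < t -> Rabs (w t i - x i) <= C * exp (- lam * t)) /\
      (forall i, (i < n)%nat -> Rabs (w0 i - x i) <= C).
Proof.
  intros Hw0 Hflow.
  destruct (a_priori_region w0 Hw0) as [eps [M [Heps [HM [_ Hreg0]]]]].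
  assert (Hreg : forall t, 0 < t -> in_region eps M (w t)).
  { intros t Ht; apply (Hreg0 (t + 1) w (Hflow (t + 1))); lra. }
  assert (Hlim : forall i, (i < n)%nat -> filterlim (fun t => w t i) (at_right 0) (locally (w0 i)))
    by apply (Hflow 0).
  assert (Hpos : forall t, 0 < t -> edges_positive (log_cosh_half T l0 (w t))).
  { intros t Ht; apply (Hflow (t + 1)); lra. }
  assert (Hder : forall i t, (i < n)%nat -> 0 < t ->
    is_derive (fun s => w s i) t (boundary_length T (log_cosh_half T l0 (w t)) i - b i)).
  { intros i t Hi Ht; apply (Hflow (t + 1)); easy || lra. }
  destruct (finite_upper_bound (edge_const l0) (nE T)) as [K [HK0 HK]].
  (* In the region an edge variable is at most [2 M + K]: two factors and one edge constant. *)
  set (D := 2 * exp (2 * (2 * M + K))).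
  assert (HD1 : 1 <= D) by (unfold D; assert (H := exp_ineq1_le (2 * (2 * M + K))); lra).
  assert (HD : forall t e, 0 < t -> (e < nE T)%nat -> edge_cosh (log_cosh_half T l0 (w t) e) <= D).
  { intros t e Ht He; destruct (Hreg t Ht) as [_ R2]; destruct (edge_endpoints e He) as [Hs Hg].
    apply R2 in Hs, Hg; specialize (HK e He).
    assert (Hle : log_cosh_half T l0 (w t) e <= 2 * M + K) by (unfold log_cosh_half; lra).
    unfold edge_cosh, D.
    assert (exp (2 * log_cosh_half T l0 (w t) e) <= exp (2 * (2 * M + K))); [|lra].
    destruct Hle as [Hle| ->]; [left; apply exp_increasing|]; lra. }
  set (lam := dissipation D); assert (Hlam : 0 < lam) by now apply dissipation_pos.
  assert (HdE : forall t, 0 < t -> exists dE, is_derive (fun s => energy (w s)) t dE /\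
     dE <= - (2 * lam) * energy (w t)).
  { intros t Ht; apply energy_dissipation; try easy; [now apply Hpos|intros; now apply HD|intros; now apply Hder]. }
  assert (Hdecay : forall t, 0 < t -> energy (w t) <= energy w0 * exp (- (2 * lam) * t)).
  { intros t Ht.
    (* Gronwall: the weight [exp (2 lam t)] makes the energy nonincreasing, with the right limit at
       0 as initial value. *)
    assert (H : energy (w t) * exp (2 * lam * t) <= energy w0 * exp (2 * lam * 0)).
    { apply (derive_nonpos_decr0 (fun s => energy (w s) * exp (2 * lam * s))
        (fun s => Derive (fun s => energy (w s)) s * exp (2 * lam * s) + energy (w s) * (2 * lam * exp (2 * lam * s)))
        (t + 1)); [| | |lra].
      - apply (filterlim_comp_2 (fun s => energy (w s)) (fun s => exp (2 * lam * s)) Rmult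
          (G := locally (energy w0)) (H := locally (exp (2 * lam * 0)))).
        + now apply filterlim_energy; [apply at_right_proper_filter| |].
        + assert (Hc : continuous (fun s => exp (2 * lam * s)) 0)
            by (apply (ex_derive_continuous (fun s => exp (2 * lam * s))); auto_derive; easy).
          intros P HP; destruct (Hc P HP) as [d Hd]; exists d; intros y Hy _; exact (Hd y Hy).
        + apply (filterlim_mult (K := R_AbsRing)).
      - intros s Hs; destruct (HdE s (proj1 Hs)) as [dE [H _]].
        replace (Derive (fun s => energy (w s)) s) with dE by (symmetry; now apply is_derive_unique).
        apply (is_derive_mult (fun s => energy (w s)) (fun s => exp (2 * lam * s))); [easy| |intros; apply Rmult_comm].
        auto_derive; [easy|ring].
      - intros s Hs; destruct (HdE s (proj1 Hs)) as [dE [H Hle]].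
        replace (Derive (fun s => energy (w s)) s) with dE by (symmetry; now apply is_derive_unique); assert (P := exp_pos (2 * lam * s)); nra. }
    rewrite Rmult_0_r, exp_0, Rmult_1_r in H.
    assert (E : exp (2 * lam * t) * exp (- (2 * lam) * t) = 1)
      by (rewrite <- exp_plus, <- exp_0; f_equal; ring).
    apply Rmult_le_compat_r with (r := exp (- (2 * lam) * t)) in H; [|apply Rlt_le, exp_pos].
    rewrite Rmult_assoc, E, Rmult_1_r in H; easy. }
  set (S := sqrt (energy w0)); assert (HS : 0 <= S) by apply sqrt_pos.
  (* The energy dominates the square of each speed, so the rate is halved from [2 lam] to [lam]. *)
  assert (Hspeed : forall i t, (i < n)%nat -> 0 < t ->
    Rabs (boundary_length T (log_cosh_half T l0 (w t)) i - b i) <= S * exp (- lam * t)).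
  { intros i t Hi Ht; assert (Hex := exp_pos (- lam * t)).
    apply Rsqr_incr_0_var; [|apply Rmult_le_pos; lra].
    rewrite <- Rsqr_abs, !Rsqr_pow2, Rpow_mult_distr.
    replace (S ^ 2) with (energy w0) by (unfold S; rewrite pow2_sqrt; [easy|apply energy_pos]).
    replace (exp (- lam * t) ^ 2) with (exp (- (2 * lam) * t))
      by (simpl; rewrite Rmult_1_r, <- exp_plus; f_equal; ring).
    apply Rle_trans with (2 := Hdecay t Ht); now apply energy_ge_term. }
  (* [exp_decay_limit] gives one limit for each coordinate; [Lim] collects them into a single
     point. *)
  set (x := fun i => real (Lim (fun t => w t i) p_infty)).
  assert (Hx : forall i, (i < n)%nat -> is_lim (fun t => w t i) p_infty (x i) /\
    forall t, 0 < t -> Rabs (w t i - x i) <= S / lam * exp (- lam * t)).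
  { intros i Hi.
    destruct (exp_decay_limit (fun t => w t i)
      (fun t => boundary_length T (log_cosh_half T l0 (w t)) i - b i) S lam) as [l [Hl Hd]]; try easy.
    - intros t Ht; now apply Hder.
    - intros t Ht; now apply Hspeed.
    - unfold x; rewrite (is_lim_unique_limit _ _ Hl); easy. }
  assert (Hxlim : forall i, (i < n)%nat -> filterlim (fun t => w t i) (Rbar_locally p_infty) (locally (x i)))
    by (intros i Hi; apply Hx; easy).
  (* The uniform margin [eps] passes to the limit, so the limit does not fall on the boundary of
     [W]. *)
  assert (Hxpos : edges_positive (log_cosh_half T l0 x)).
  { intros e He; apply Rlt_le_trans with (1 := Heps).
    apply (filterlim_le (F := Rbar_locally p_infty) (fun _ => eps) (fun t => log_cosh_half T l0 (w t) e)
             eps (log_cosh_half T l0 x e)).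
    - exists 0; intros t Ht; now apply Hreg.
    - apply filterlim_const.
    - now apply (filterlim_log_cosh_half (Rbar_locally p_infty)). }
  assert (HSl : 0 <= S / lam) by (apply Rdiv_le_0_compat; lra).
  exists x; split; [easy|split].
  - intros i Hi.
    assert (HB := filterlim_boundary_length (Rbar_locally p_infty) w x i Hxlim Hxpos).
    assert (HB' : is_lim (fun t => boundary_length T (log_cosh_half T l0 (w t)) i - b i) p_infty
      (boundary_length T (log_cosh_half T l0 x) i - b i)).
    { apply (is_lim_minus' _ _ p_infty); [exact HB|apply is_lim_const]. }
    assert (Hz : Rabs (boundary_length T (log_cosh_half T l0 x) i - b i) <= 0).
    { apply (filterlim_le (F := Rbar_locally p_infty)
        (fun t => Rabs (boundary_length T (log_cosh_half T l0 (w t)) i - b i))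
        (fun t => S * exp (- lam * t)) (Rabs (boundary_length T (log_cosh_half T l0 x) i - b i)) 0).
      - exists 0; intros t Ht; now apply Hspeed.
      - exact (is_lim_Rabs _ _ _ HB').
      - exact (is_lim_scaled_exp_decay S lam Hlam). }
    assert (Hz' := Rabs_pos (boundary_length T (log_cosh_half T l0 x) i - b i)).
    assert (boundary_length T (log_cosh_half T l0 x) i - b i = 0) by (apply Rabs_eq_0; lra). lra.
  (* The summand 1 makes the constant positive even when the flow starts at an equilibrium, where
     [S = 0]. *)
  - exists (S / lam + 1), lam; split; [lra|split; [easy|split]].
    + intros i t Hi Ht; apply Rle_trans with (1 := proj2 (Hx i Hi) t Ht).
      apply Rmult_le_compat_r; [apply Rlt_le, exp_pos|lra].
    + intros i Hi.
      (* The estimate at time 0 is the limit from the right of the estimates at positive times; the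
         signs fit the form of [at_right_le]. *)
      assert (- (S / lam) <= - Rabs (w0 i - x i)); [|lra].
      apply (at_right_le (fun t => - Rabs (w t i - x i)) 0 1); [lra| |].
      * apply (filterlim_comp _ _ _ (fun t => w t i) (fun u => - Rabs (u - x i)) _ (locally (w0 i)) _ (Hlim i Hi)).
        apply (continuous_opp (V := R_NormedModule) (fun u => Rabs (u - x i))).
        apply (continuous_comp (fun u => u - x i) Rabs); [|apply continuous_Rabs].
        apply (ex_derive_continuous (fun u => u - x i)); auto_derive; easy.
      * intros s Hs; apply Ropp_le_contravar.
        apply Rle_trans with (1 := proj2 (Hx i Hi) s (proj1 Hs)).
        rewrite <- (Rmult_1_r (S / lam)) at 2; apply Rmult_le_compat_l; [easy|].
        rewrite <- exp_0; left; apply exp_increasing; nra.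
Qed.

End Surface.

Theorem theorem1p2 (T : tri_data) (l0 b w0 : nat -> R)
  (HT : closed_surface_triangulation T)
  (Hl0 : forall e, (e < nE T)%nat -> 0 < l0 e)
  (Hb : forall i, (i < nV T)%nat -> 0 < b i)
  (Hw0 : admissible T l0 w0) :
  (exists w : R -> nat -> R, yamabe_solution T l0 b w0 w) /\
  (forall w : R -> nat -> R, yamabe_solution T l0 b w0 w ->
     exists wstar : nat -> R,
       admissible T l0 wstar /\
       (forall i, (i < nV T)%nat -> Blen T l0 wstar i = b i) /\
       exists C lam0 : R, 0 < C /\ 0 < lam0 /\
         forall i t, (i < nV T)%nat -> 0 <= t ->
           Rabs (w t i - wstar i) <= C * exp (- lam0 * t)).
Proof.
  apply admissible_iff in Hw0; split.
  - destruct (flow_exists T l0 b HT Hb w0 Hw0) as [w [H0 [Hpos Hflow]]].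
    exists w; split; [easy|split; [|split]].
    + intros t Ht; now apply admissible_iff, Hpos.
    + apply (Hflow 0).
    + intros i t Hi Ht; rewrite Blen_boundary_length; [|easy|].
      * apply (Hflow (t + 1)); [easy|lra].
      * apply admissible_iff, Hpos; lra.
  - intros w [H0 [Hadm [Hlim Hder]]].
    destruct (flow_converges T l0 b HT Hb w0 w Hw0) as [x [Hx [HB [C [lam [HC [Hlam [Hbd Hbd0]]]]]]]].
    { intros tau; split; [easy|split].
      - intros t Ht; apply admissible_iff, Hadm; lra.
      - intros i t Hi Ht; rewrite <- Blen_boundary_length; [now apply Hder|easy|apply Hadm; lra]. }
    exists x; split; [now apply admissible_iff|split].
    + intros i Hi; rewrite Blen_boundary_length; [now apply HB|easy|now apply admissible_iff].
    + exists C, lam; split; [easy|split; [easy|]]; intros i t Hi [Ht| <-]; [now apply Hbd|].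
      rewrite Rmult_0_r, exp_0, Rmult_1_r, H0; [now apply Hbd0|easy].
Qed.
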